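(* Let $0<\alpha<1$, $T>0$, $J=[0,T]$, $\omega_0\in\mathbb{R}$, $b>0$, $M>0$, and $R_0=\{(\tau,\omega):\tau\in J,\ |\omega-\omega_0|\le b\}$. Let $f\in C(J\times\mathbb{R},\mathbb{R})$ with $f(0,\omega_0)=0$ be such that $|f(\tau,\omega)|\le M$ for all $(\tau,\omega)\in R_0$ and $$|f(\tau_1,\omega)-f(\tau_2,\eta)|\le L_1|\tau_1-\tau_2|+L_2|\omega-\eta|,\quad \tau_1,\tau_2\in J,\ \omega,\eta\in\mathbb{R},$$ where $L_1>0$ and $0<L_2<\frac{B(\alpha)}{1-\alpha}$. If $(2M+b)(1-\alpha)<bB(\alpha)$, then the initial value problem $${}^{ABC}{}_0\mathcal{D}_\tau^\alpha\omega(\tau)=f(\tau,\omega(\tau)),\qquad \omega(0)=\omega_0,$$ has extremal solutions (a maximal solution and a minimal solution) on $J''=[0,\beta_0]$, where $$\beta_0=\min\left\{T,\ \left[\frac{(bB(\alpha)-(2M+b)(1-\alpha))\,\Gamma(\alpha)}{2M+b}\right]^{1/\alpha}\right\}.$$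
   Context: Let $0<\alpha<1$ and let $B$ be a fixed normalization function on $[0,1]$ with $B(\alpha)>0$ and $B(0)=B(1)=1$. The one-parameter Mittag-Leffler function is $\mathbb{E}_\alpha(z)=\sum_{n=0}^\infty \frac{z^n}{\Gamma(n\alpha+1)}$. For an interval $[0,a]$ and $\omega\in H^1(0,a)$ (Sobolev space), the left Atangana--Baleanu--Caputo (ABC) fractional derivative of order $\alpha$ is ${}^{ABC}{}_0\mathcal{D}_\tau^\alpha\omega(\tau)=\frac{B(\alpha)}{1-\alpha}\int_0^\tau \mathbb{E}_\alpha\left[-\frac{\alpha}{1-\alpha}(\tau-\sigma)^\alpha\right]\omega'(\sigma)\,d\sigma$. Functions to which this operator is applied are understood to lie in its domain. A solution on $[0,a]$ is a function $\omega$ with $\omega,\ {}^{ABC}{}_0\mathcal{D}_\tau^\alpha\omega\in C([0,a])$ satisfying the equation at every point of $[0,a]$ and the initial condition. A maximal (resp. minimal) solution on $[0,a]$ is a solution $\eta$ such that every solution $\omega$ on $[0,a]$ of the same initial value problem satisfies $\omega(\tau)\le\eta(\tau)$ (resp. $\omega(\tau)\ge\eta(\tau)$) for all $\tau\in[0,a]$. *)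

(* Defs.v *)
From HB Require Import structures.
From mathcomp Require Import all_boot all_order all_algebra.
From mathcomp Require Import all_classical all_reals all_analysis.

Set Implicit Arguments.
Unset Strict Implicit.
Unset Printing Implicit Defensive.

Import Order.TTheory GRing.Theory Num.Theory.
Import numFieldNormedType.Exports.

Local Open Scope classical_set_scope.
Local Open Scope ring_scope.

(* Euler's integral; only used at arguments x > 0, where it converges. *)
Definition Gamma (R : realType) (x : R) : R :=
  \int[lebesgue_measure]_(t in `]0, +oo[) (t `^ (x - 1) * expR (- t)).

Definition mittag_leffler (R : realType) (alpha z : R) : R :=
  limn [series z ^+ n / Gamma (n%:R * alpha + 1)]_n.

(* The space L^2(0, a); [g \_ D] is g on D, extended by 0. *)
Definition in_L2 (R : realType) (a : R) (g : R -> R) : Prop :=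
  (g \_ `]0, a[) \in Lfun (@lebesgue_measure R) 2%:E.

(* phi is of class C^1 with compact support in the open interval (0, a). *)
Definition test_function (R : realType) (a : R) (phi : R -> R) : Prop :=
  [/\ forall x, derivable phi x 1,
      continuous (derive1 phi) &
      exists K : set R,
        [/\ compact K, K `<=` `]0, a[ & forall x, ~ K x -> phi x = 0] ].

Definition is_weak_derivative (R : realType) (a : R) (w g : R -> R) : Prop :=
  in_L2 a g /\
  forall phi : R -> R, test_function a phi ->
    \int[lebesgue_measure]_(x in `]0, a[) (w x * derive1 phi x) =
    - \int[lebesgue_measure]_(x in `]0, a[) (g x * phi x).

(* The Sobolev space H^1(0, a) = W^{1,2}(0, a), as defined in H. Brezis,
   Functional Analysis, Sobolev Spaces and Partial Differential Equations,
   section 8.2 (there too with C^1 test functions). *)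
Definition H1 (R : realType) (a : R) (w : R -> R) : Prop :=
  in_L2 a w /\ exists g : R -> R, is_weak_derivative a w g.

(* A chosen representative of the weak derivative, which is unique up to a
   null set of (0, a); it is the zero function if there is none. *)
Definition weak_derivative (R : realType) (a : R) (w : R -> R) : R -> R :=
  xget (fun=> 0) [set g | is_weak_derivative a w g].

(* The left ABC derivative on [0, a].  The bound a only serves to fix the
   interval on which the weak derivative w' is taken. *)
Definition ABC (R : realType) (alpha : R) (B : R -> R) (a : R) (w : R -> R)
    (tau : R) : R :=
  B alpha / (1 - alpha) *
  \int[lebesgue_measure]_(sigma in `[0, tau])
    (mittag_leffler alpha (- (alpha / (1 - alpha)) * (tau - sigma) `^ alpha) *
     weak_derivative a w sigma).

Definition is_solution (R : realType) (alpha : R) (B : R -> R) (f : R -> R -> R)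
    (w0 a : R) (w : R -> R) : Prop :=
  [/\ H1 a w,
      {within `[0, a], continuous w},
      {within `[0, a], continuous (ABC alpha B a w)},
      forall tau, tau \in `[0, a] -> ABC alpha B a w tau = f tau (w tau) &
      w 0 = w0].

Definition is_maximal_solution (R : realType) (alpha : R) (B : R -> R)
    (f : R -> R -> R) (w0 a : R) (eta : R -> R) : Prop :=
  is_solution alpha B f w0 a eta /\
  forall w : R -> R, is_solution alpha B f w0 a w ->
    forall tau, tau \in `[0, a] -> w tau <= eta tau.

Definition is_minimal_solution (R : realType) (alpha : R) (B : R -> R)
    (f : R -> R -> R) (w0 a : R) (eta : R -> R) : Prop :=
  is_solution alpha B f w0 a eta /\
  forall w : R -> R, is_solution alpha B f w0 a w ->
    forall tau, tau \in `[0, a] -> eta tau <= w tau.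

(* Main.v *)
Require Import Defs.
From HB Require Import structures.
From mathcomp Require Import all_boot all_order all_algebra.
From mathcomp Require Import all_classical all_reals all_analysis.
From mathcomp Require Import measurable_realfun.
From mathcomp Require Import ring lra.
Import Order.TTheory GRing.Theory Num.Theory.
Import numFieldNormedType.Exports.
Local Open Scope classical_set_scope.
Local Open Scope ring_scope.

(** Write [c = (1 - alpha) / B alpha], [lam = alpha / (1 - alpha)], [I] for the
    Riemann-Liouville integral of order [alpha], and [e_m] for the function
    [t |-> E_alpha (m t^alpha)].  Since [f] is globally Lipschitz with
    [c L2 < 1], the problem has exactly one solution on [0, a] for every
    [0 < a <= T], in particular for [a = beta0]; a unique solution is both
    maximal and minimal.

    The link with integral equations is the identity
    [m I e_m = e_m - 1] ([frac_int_ml_fun]): by Euler's Beta integral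
    ([pw_conv]), [I] shifts the terms of the Mittag-Leffler series by one.  For
    [m = - lam] it concerns the kernel [k] of the ABC derivative, which is the
    convolution of [k] and [w'] divided by [c].  Convolving
    [k + lam I k = 1] with [w'] shows that [z], the convolution of [k] and
    [w'], satisfies [z + lam I z = w - w 0] ([memory_equation]).  Hence the
    ABC equation [z = c F], with [F t = f t (w t)], is equivalent to
    [w = w0 + c (F + lam I F)] ([ABC_Volterra]); one direction is
    substitution, the other one is uniqueness for [z + lam I z = 0].  For a
    continuous function of the Sobolev space, [w - w 0] is the primitive of
    the weak derivative by the lemma of du Bois-Reymond
    ([weak_derivative_primitive]).

    For [m > 0] the same identity makes [e_m] a weight: in the supremum norm
    weighted by [e_m], the operator [I] has norm at most [1 / m]
    ([norm_frac_int_weight]).  So the right-hand side of the Volterra equation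
    contracts by [c L2 (1 + lam / m)], which is less than 1 for large [m].
    This yields uniqueness ([Volterra_unique]) and convergence of the Picard
    iterates ([Volterra_fixed_point]).

    The limit must moreover have a weak derivative.  The iterates all satisfy
    [|w t - w s| <= K (t - s) e_m t] for [s <= t], with one constant [K]: this
    class is stable because [I] commutes with translations and because
    [f 0 w0 = 0] lets one extend [F] by 0 to negative times without a jump.
    So the limit is Lipschitz, therefore the primitive of a bounded function
    by the Radon-Nikodym theorem ([lipschitz_density]), and such a function is
    its weak derivative ([primitive_weak_derivative]). *)

(** * Integrable functions on the line *)

Section Integrable_functions.
Context {R : realType}.
Notation mu := (@lebesgue_measure R).
Implicit Types (u v w : R -> R).

Definition L1 u : Prop := mu.-integrable setT (EFin \o u).

Lemma L1_measurable u : L1 u -> measurable_fun setT u.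
Proof. by move=> /(measurable_int mu) /measurable_EFinP. Qed.

Lemma L1_dominated u v : measurable_fun setT u ->
  (forall x, `|u x| <= v x) -> L1 v -> L1 u.
Proof.
move=> mu_ uv Lv; apply: le_integrable Lv => //; first exact/measurable_EFinP.
by move=> x _ /=; rewrite lee_fin (le_trans (uv x))// ler_norm.
Qed.

Lemma L1D u v : L1 u -> L1 v -> L1 (fun x => u x + v x).
Proof. by move=> Lu Lv; exact: (integrableD measurableT Lu Lv). Qed.

Lemma L1Z c u : L1 u -> L1 (fun x => c * u x).
Proof. by move=> Lu; exact: (integrableZl measurableT c Lu). Qed.

Lemma L1B u v : L1 u -> L1 v -> L1 (fun x => u x - v x).
Proof. by move=> Lu Lv; exact: (integrableB measurableT Lu Lv). Qed.

Lemma L1_norm u : L1 u -> L1 (fun x => `|u x|).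
Proof.
move=> Lu; apply: (L1_dominated _ (fun x => `|u x|)).
- by apply: measurableT_comp => //; exact: L1_measurable.
- by move=> x; rewrite normr_id.
- exact: (integrable_abse Lu).
Qed.

Lemma L1M_bounded C u v : L1 u -> measurable_fun setT v ->
  (forall x, `|v x| <= C) -> L1 (fun x => u x * v x).
Proof.
move=> Lu mv vC; apply: (L1_dominated _ (fun x => C * `|u x|)).
- by apply: measurable_funM => //; exact: L1_measurable.
- by move=> x; rewrite normrM mulrC ler_wpM2r.
- by apply: L1Z; exact: L1_norm.
Qed.

Lemma L1_restrict (D : set R) u : measurable D ->
  L1 (u \_ D) <-> mu.-integrable D (EFin \o u).
Proof.
move=> mD; rewrite /L1 -restrict_EFin.
by have H := integrable_mkcond (mu := mu) (EFin \o u) mD; split=> ?; apply/H.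
Qed.

Lemma L1_bounded_support C u (a b : R) : measurable_fun setT u ->
  (forall x, `|u x| <= C) -> (forall x, x \notin `[a, b] -> u x = 0) -> L1 u.
Proof.
move=> mu_ uC u0; apply: (L1_dominated _ ((cst C) \_ `[a, b])) => //.
  move=> x; rewrite patchE; case: ifPn => [_|]; first exact: uC.
  by rewrite notin_setE => /= /negP xab; rewrite u0 ?normr0//; exact/negP.
apply/L1_restrict => //; apply: measurable_bounded_integrable => //=.
  rewrite lebesgue_measure_itv/=; case: ifP => // _.
  by rewrite -EFinB ltry.
by exists `|C|; split => // M CM x _ /=; exact: ltW.
Qed.

(** The setting shared by the convolution with the memory kernel and by
    integration by parts. *)
Section bounded_kernel.
Context (C : R) (u v : R -> R) (m : R * R -> R).
Context (Lu : L1 u) (Lv : L1 v).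
Context (mm : measurable_fun setT m) (mC : forall z, `|m z| <= C).

Let L1_mul_v x : L1 (fun y => v y * m (x, y)).
Proof.
apply: (L1M_bounded C) => //.
by apply: measurableT_comp => //; exact: measurable_pair1.
Qed.

Let L1_mul_u y : L1 (fun x => u x * m (x, y)).
Proof.
apply: (L1M_bounded C) => //.
by apply: measurableT_comp => //; exact: measurable_pair2.
Qed.

Let f (z : R * R) := ((u z.1 * m z * v z.2)%:E).

Let integral_f x : (\int[mu]_y f (x, y) = (u x * \int[mu]_y (m (x, y) * v y))%:E)%E.
Proof.
rewrite EFinM fineK; last first.
  have := integrable_fin_num measurableT (L1_mul_v x).
  by under eq_integral do rewrite /= mulrC.
rewrite -integralZl//; last first.
  by have := L1_mul_v x; apply: eq_integrable => // y _ /=; rewrite mulrC.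
by apply: eq_integral => y _; rewrite /f/= -EFinM mulrA.
Qed.

(** Keeping the kernel in the form [u x * m (x, y) * v y], with [m] bounded,
    makes it dominated by a product of integrable functions of one variable,
    so that Tonelli gives its integrability on the plane. *)
Let integrable_f : (mu \x mu)%E.-integrable setT f.
Proof.
have mf : measurable_fun setT f.
  apply/measurable_EFinP; apply: measurable_funM; last first.
    by apply: measurableT_comp => //; exact: L1_measurable.
  apply: measurable_funM => //.
  by apply: measurableT_comp => //; exact: L1_measurable.
have mmx x : measurable_fun setT (fun y => m (x, y)).
  by apply: measurableT_comp => //; exact: measurable_pair1.
have Hi := @integrable12ltyP _ _ _ _ _ mu mu f mf; apply/Hi => {Hi}.
have Hb x : (\int[mu]_y `|f (x, y)| <=
    (`|u x| * (C * \int[mu]_y `|v y|))%:E)%E.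
  rewrite /Rintegral 2!EFinM fineK; last first.
    exact: (integrable_fin_num measurableT (L1_norm _ Lv)).
  have C0 : 0 <= C := le_trans (normr_ge0 _) (mC (0, 0)).
  rewrite -ge0_integralZl//; last first.
    apply/measurable_EFinP; apply: L1_measurable; exact: L1_norm.
  rewrite -ge0_integralZl//; last 2 first.
    by apply/measurable_EFinP/measurable_funM => //; apply: L1_measurable; exact: L1_norm.
    by move=> y _; rewrite -EFinM lee_fin mulr_ge0.
  apply: ge0_le_integral => //.
  - apply: measurableT_comp => //; apply/measurable_EFinP => /=.
    have H : measurable_fun setT (fun y => u x * m (x, y) * v y).
      apply: measurable_funM; last exact: L1_measurable.
      by apply: measurable_funM.
    exact: H.
  - have H : measurable_fun setT (fun y => `|u x| * (C * `|v y|)).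
      by apply: L1_measurable; do 2!apply: L1Z; exact: L1_norm.
    by apply/measurable_EFinP; exact: H.
  - by move=> y _; rewrite lee_fin/= !normrM -mulrA ler_wpM2l// ler_wpM2r.
apply: le_lt_trans (_ : (\int[mu]_x (`|u x| * (C * \int[mu]_y `|v y|))%:E < +oo)%E).
  apply: ge0_le_integral => //.
  - by move=> x _; exact: integral_ge0.
  - have maf : measurable_fun setT (abse \o f) by exact: measurableT_comp.
    exact: (measurable_fun_fubini_tonelli_F (m2 := mu) (abse \o f) maf (fun=> abse_ge0 _)).
  - apply/measurable_EFinP/measurable_funM => //.
    apply: L1_measurable; exact: L1_norm.
rewrite ltey_eq; apply/orP; left.
have := L1Z (C * \int[mu]_y `|v y|) _ (L1_norm _ Lu).
move=> /(integrable_fin_num measurableT).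
by under eq_integral do rewrite /= mulrC.
Qed.

Lemma L1_kernel : L1 (fun x => u x * \int[mu]_y (m (x, y) * v y)).
Proof.
have := integrable_fubini_F integrable_f.
by apply: eq_integrable => // x _; rewrite /fubini_F integral_f.
Qed.

Lemma Rintegral_Fubini :
  \int[mu]_x (u x * \int[mu]_y (m (x, y) * v y)) =
  \int[mu]_y (v y * \int[mu]_x (u x * m (x, y))).
Proof.
have H := Fubini integrable_f.
rewrite [LHS]/Rintegral [RHS]/Rintegral; congr fine.
transitivity (\int[mu]_x \int[mu]_y f (x, y))%E.
  by apply: eq_integral => x _; rewrite integral_f.
rewrite H; apply: eq_integral => y _; rewrite EFinM fineK; last first.
  exact: (integrable_fin_num measurableT (L1_mul_u y)).
rewrite -integralZl//; last exact: L1_mul_u.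
by apply: eq_integral => x _; rewrite /f/= -EFinM mulrC.
Qed.

End bounded_kernel.

(** The image of Lebesgue measure under the affine map, scaled by [c], has the
    right values on intervals, which determine Lebesgue measure. *)
Lemma ge0_integral_affine c d (f : R -> \bar R) : 0 < c ->
  measurable_fun setT f -> (forall x, 0%E <= f x)%E ->
  (\int[mu]_x f x = c%:E * \int[mu]_x f (c * x + d)%R)%E.
Proof.
move=> c0 mf f0.
have mphi : measurable_fun setT (fun x : measurableTypeR R => (c * x + d : measurableTypeR R)).
  by apply: measurable_funD => //; exact: measurable_funM.
pose cn : {nonneg R} := NngNum (ltW c0).
rewrite -(ge0_integral_pushforward mphi mu measurableT mf)//.
rewrite -(ge0_integral_mscale _ measurableT cn)//.
apply: eq_measure_integral => A mA _; apply: lebesgue_measure_unique => //.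
move=> X /ocitvP[->|[[x y] /= xy ->]].
  by rewrite !measure0.
rewrite /mscale/= /pushforward/=.
rewrite (_ : _ @^-1` _ = `](x - d) / c, (y - d) / c]%classic); last first.
  apply/seteqP; split => z /=; rewrite !in_itv/= ltr_pdivrMr// ler_pdivlMr//;
  by rewrite ltrBlDr lerBrDr mulrC.
rewrite !lebesgue_measure_itv/= !lte_fin xy ltr_pM2r ?invr_gt0// ltrD2r xy.
rewrite -!EFinB -EFinM; congr EFin; field; exact: lt0r_neq0.
Qed.

End Integrable_functions.

(** * Gamma and Beta integrals *)

Section Euler_integrals.
Context {R : realType}.
Notation mu := (@lebesgue_measure R).
Implicit Types x y t : R.

(** Powers extended by 0 to negative arguments, so that convolutions of powers
    are integrals over the line. *)
Definition pw x t : R := if 0 <= t then t `^ x else 0.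

Lemma pw_ge0 x t : 0 <= pw x t.
Proof. by rewrite /pw; case: ifP => // _; exact: powR_ge0. Qed.

Lemma measurable_pw x : measurable_fun setT (pw x).
Proof.
rewrite /pw; apply: measurable_fun_ifT => //.
exact: measurable_fun_ler.
Qed.

Lemma pwM x t r : 0 < t -> pw x (t * r) = t `^ x * pw x r.
Proof.
move=> t0; rewrite /pw pmulr_rge0//; case: ifPn => r0; last by rewrite mulr0.
by rewrite powRM// ltW.
Qed.

(** Monotone convergence along the intervals [1 / (n + 1), 1], on which the
    power is continuous also for [x < 1]. *)
Lemma integral_powR_itv01 x : 0 < x ->
  (\int[mu]_(t in `]0%R, 1%R]) (x * t `^ (x - 1))%:E <= 1)%E.
Proof.
move=> x0; pose F (n : nat) : set R := `[n.+1%:R^-1, 1]%classic.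
have FE : `]0%R, 1%R]%classic = \bigcup_i F i.
  apply/seteqP; split => t /=; rewrite in_itv/=.
    move=> /andP[t0 t1]; exists (Num.bound t^-1) => //=.
    rewrite /F/= in_itv/= t1 andbT -[leRHS]invrK lef_pV2// ?posrE ?invr_gt0//.
    have tV : 0 <= t^-1 by rewrite invr_ge0 ltW.
    by rewrite ltW// (lt_le_trans (archi_boundP tV))// ler_nat.
  move=> [n _]; rewrite /F/= in_itv/= => /andP[nt ->]; rewrite andbT.
  by rewrite (lt_le_trans _ nt).
have mF n : measurable (F n) by exact: measurable_itv.
have mf D : measurable_fun D (fun t => (x * t `^ (x - 1))%:E).
  apply: (@measurable_funS _ _ _ _ setT) => //.
  apply/measurable_EFinP; apply: measurable_funM => //; exact: measurable_powR.
have f0 t : (0 <= (x * t `^ (x - 1))%:E)%E.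
  by rewrite lee_fin mulr_ge0 ?powR_ge0// ltW.
rewrite FE; have := @ge0_nondecreasing_set_cvg_integral _ (measurableTypeR R) R F
  (fun t => (x * t `^ (x - 1))%:E) mu.
move=> /(_ _ mF (fun=> mf _) (fun _ t _ => f0 t)) H.
have ndF : {homo F : n m / (n <= m)%N >-> (n <= m)%O}.
  move=> m n mn; apply/subsetPset; apply: subset_itvr; rewrite bnd_simp.
  by rewrite lef_pV2 ?posrE// ler_nat.
apply: (cvge_to_le (H ndF)); apply: nearW => n; have [->|n0] := eqVneq n 0%N.
  by rewrite /F invr1 set_itv1 integral_set1.
have n1 : n.+1%:R^-1 < 1 :> R.
  by rewrite invf_lt1// ltr1n ltnS lt0n.
have np : 0 < n.+1%:R^-1 :> R by [].
have dF t : 0 < t -> is_derive t 1 ((@powR R)^~ x) (x * t `^ (x - 1)).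
  by move=> t0; exact: is_derive1_powR.
have cF t : 0 < t -> {for t, continuous ((@powR R)^~ x)}.
  move=> t0; apply: differentiable_continuous; apply/derivable1_diffP.
  by have [] := dF _ t0.
rewrite (@continuous_FTC2 _ _ ((@powR R)^~ x))//.
- by rewrite -EFinB lee_fin powR1 lerBlDr lerDl powR_ge0.
- apply: derivable_within_continuous => t; rewrite in_itv/= => /andP[nt _].
  have t0 : 0 < t by exact: lt_le_trans nt.
  apply: derivableM => //.
  by have [] := is_derive1_powR (x - 1) t0.
- split.
  + move=> t; rewrite in_itv/= => /andP[nt _].
    by have [] := dF t (lt_trans np nt).
  + by apply: cvg_at_right_filter; exact: cF.
  + by apply: cvg_at_left_filter; exact: cF.
- move=> t; rewrite in_itv/= => /andP[nt _]; rewrite derive1E.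
  exact: (@derive_val _ _ _ _ _ _ _ (dF t (lt_trans np nt))).
Qed.

Definition gamma_density x t : R := pw (x - 1) t * expR (- t).

Lemma gamma_density_ge0 x t : 0 <= gamma_density x t.
Proof. by rewrite mulr_ge0 ?pw_ge0 ?expR_ge0. Qed.

Lemma measurable_gamma_density x : measurable_fun setT (gamma_density x).
Proof.
apply: measurable_funM; first exact: measurable_pw.
by apply: measurableT_comp => //; exact: measurable_funN.
Qed.

Lemma GammaE x : Gamma x = \int[mu]_t gamma_density x t.
Proof.
rewrite /Gamma /Rintegral; congr fine.
rewrite integral_itv_obnd_cbnd; last first.
  apply/measurable_EFinP; apply: (@measurable_funS _ _ _ _ setT) => //.
  apply: measurable_funM; first exact: measurable_powR.
  by apply: measurableT_comp => //; exact: measurable_funN.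
rewrite [LHS]integral_mkcond; apply: eq_integral => t _.
rewrite patchE /gamma_density /pw; case: ifPn => [|].
  by rewrite inE/= in_itv/= andbT => ->.
by rewrite notin_setE/= in_itv/= andbT => /negP/negbTE ->; rewrite mul0r.
Qed.

Lemma powR_le_expR x : exists C : R, forall t, 1 <= t ->
  t `^ x <= C * expR (t / 2).
Proof.
pose y := Num.max x 0 + 1.
have y0 : 0 < y by rewrite ltr_wpDl// le_max lexx orbT.
exists (expR (y * (ln (2 * y)))) => t t1.
have t0 : 0 < t by exact: lt_le_trans t1.
have xy : t `^ x <= t `^ y.
  by rewrite ler_powR// /y (@le_trans _ _ (Num.max x 0))// ?le_max ?lexx// lerDl.
rewrite (le_trans xy)// /powR gt_eqF// -expRD ler_expR.
have y20 : 0 < 2 * y by rewrite mulr_gt0.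
have -> : t = (2 * y) * (t / (2 * y)) by field; exact: lt0r_neq0.
have ty0 : 0 < t / (2 * y) by rewrite divr_gt0.
rewrite lnM ?posrE// mulrDr lerD2l.
(* [ln u <= u - 1] at [u = t / (2 y)] *)
have := @le_ln1Dx _ (t / (2 * y) - 1).
rewrite ltrBrDl subrr ty0 addrC subrK => /(_ isT) H.
rewrite (@le_trans _ _ (y * (t / (2 * y))))//.
  by rewrite ler_pM2l// (le_trans H)// gerBl.
rewrite [X in X <= _](_ : _ = t / 2); last by field; exact: lt0r_neq0.
by rewrite [X in _ <= X](_ : _ = t / 2)//; field; exact: lt0r_neq0.
Qed.

Lemma L1_exponential_half : L1 (fun t => pw 0 t * expR (- (t / 2))).
Proof.
apply/integrableP; split.
  apply/measurable_EFinP; apply: measurable_funM; first exact: measurable_pw.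
  apply: measurableT_comp => //; apply: measurable_funN; exact: measurable_funM.
have half_gt0 : 0 < 2^-1 :> R by rewrite invr_gt0.
have H := integral_exponential_pdf half_gt0.
rewrite (_ : (\int[_]_x _)%E = (2%:E * \int[mu]_x (exponential_pdf 2^-1 x)%:E)%E).
  by rewrite H mule1 ltry.
rewrite -ge0_integralZl//=; last 2 first.
  by apply/measurable_EFinP; exact: measurable_exponential_pdf.
  by move=> t _; rewrite lee_fin exponential_pdf_ge0// invr_ge0.
apply: eq_integral => t _; rewrite ger0_norm; last first.
  by rewrite mulr_ge0 ?pw_ge0 ?expR_ge0.
rewrite -EFinM; congr EFin; rewrite /exponential_pdf patchE /pw powRr0.
case: ifPn => t0; last first.
  by rewrite ifN ?mul0r ?mulr0// notin_setE/= in_itv/= andbT; exact/negP.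
rewrite mem_set/= ?in_itv/= ?t0// mul1r mulrA divff// mul1r.
by rewrite mulNr mulrC.
Qed.

(** The density is dominated by [t^(x - 1)] on ]0, 1] and by a multiple of
    [e^(- t / 2)] on ]1, +oo[; the point 0 has a term of its own in the
    bound. *)
Lemma L1_gamma_density x : 0 < x -> L1 (gamma_density x).
Proof.
move=> x0.
have [C HC] := powR_le_expR (x - 1).
have C0 : 0 <= C.
  by have := HC _ (lexx 1); rewrite powR1; apply: contraTT; rewrite -!ltNge => C0;
   rewrite (lt_trans _ ltr01)// nmulr_rlt0// expR_gt0.
apply: (L1_dominated _ (fun t => x^-1 * ((fun t => x * t `^ (x - 1)) \_ `]0, 1]) t
    + (C * (pw 0 t * expR (- (t / 2))) + `|((cst (gamma_density x 0)) \_ [set 0]) t|))).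
- exact: measurable_gamma_density.
- move=> t; rewrite ger0_norm ?gamma_density_ge0//.
  have E0 : 0 <= C * (pw 0 t * expR (- (t / 2))).
    by rewrite !mulr_ge0 ?pw_ge0 ?expR_ge0.
  have G0 s : 0 <= x^-1 * ((fun t => x * t `^ (x - 1)) \_ `]0, 1]) s.
    rewrite patchE; case: ifP => _; last by rewrite mulr0.
    by rewrite mulKf ?gt_eqF// powR_ge0.
  have [t0|t0|->] := ltgtP t 0.
  + rewrite /gamma_density /pw (lt_geF t0) !mul0r
      mulr0 add0r addr_ge0//; exact: G0.
  + have [t1|t1] := leP t 1.
      rewrite [X in _ <= _ * X + _]patchE mem_set/= ?in_itv/= ?t0//.
      rewrite mulKf ?gt_eqF// ler_wpDr ?addr_ge0//.
      rewrite /gamma_density /pw (ltW t0) ler_piMr ?powR_ge0//.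
      by rewrite -expR0 ler_expR oppr_le0 ltW.
    rewrite -[leLHS]add0r lerD ?G0//.
    rewrite ler_wpDr// /gamma_density /pw (ltW t0) powRr0 mul1r.
    rewrite (@le_trans _ _ (C * expR (t / 2) * expR (- t)))//.
      by rewrite ler_wpM2r ?expR_ge0// HC// ltW.
    rewrite -mulrA -expRD ler_wpM2l// ler_expR; lra.
  + rewrite [X in _ <= _ + (_ + `|X|)]patchE mem_set//= ler_wpDl ?G0// ler_wpDl ?ler_norm//.
    by rewrite !mulr_ge0 ?pw_ge0 ?expR_ge0.
- apply: L1D.
    apply: L1Z; apply/L1_restrict => //.
    apply/integrableP; split.
      apply: (@measurable_funS _ _ _ _ setT) => //.
      apply/measurable_EFinP; apply: measurable_funM => //; exact: measurable_powR.
    apply: le_lt_trans (ltry 1); apply: le_trans (integral_powR_itv01 _ x0).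
    rewrite le_eqVlt; apply/orP; left; apply/eqP; apply: eq_integral => t _ /=.
    by rewrite ger0_norm// mulr_ge0 ?powR_ge0 ?ltW.
  apply: L1D; first by apply: L1Z; exact: L1_exponential_half.
  apply: L1_norm; apply/L1_restrict => //.
  apply: measurable_bounded_integrable => //=.
    by rewrite lebesgue_measure_set1 ltry.
  exists `|gamma_density x 0|; split => // M CM t _ /=; exact: ltW.
Qed.

Lemma Gamma_fin x : 0 < x -> (\int[mu]_t (gamma_density x t)%:E = (Gamma x)%:E)%E.
Proof.
move=> x0; rewrite GammaE fineK//.
exact: (integrable_fin_num measurableT (L1_gamma_density _ x0)).
Qed.

Lemma Gamma1 : Gamma 1 = 1 :> R.
Proof.
rewrite GammaE /Rintegral.
rewrite [X in fine X](_ : _ = (\int[mu]_x (exponential_pdf 1 x)%:E)%E).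
  by rewrite integral_exponential_pdf.
apply: eq_integral => t _; congr EFin.
rewrite /gamma_density /exponential_pdf patchE /pw subrr powRr0.
case: ifPn => t0; last first.
  by rewrite ifN ?mul0r ?mulr0// notin_setE/= in_itv/= andbT; exact/negP.
by rewrite mem_set/= ?in_itv/= ?t0// !mul1r mulN1r.
Qed.

(** The integral over a unit interval is enough both for positivity and for the
    growth of the Gamma function. *)
Lemma Gamma_lower_bound x c u : 0 < x ->
  (forall t, u <= t <= u + 1 -> c <= gamma_density x t) -> c <= Gamma x.
Proof.
move=> x0 cG; rewrite GammaE.
have -> : c = \int[mu]_t ((cst c) \_ `[u, u + 1]) t.
  rewrite -Rintegral_mkcond /= Rintegral_cst//= lebesgue_measure_itv/= lte_fin.
  by rewrite ltrDl ltr01/= addrAC subrr add0r mulr1.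
apply: le_Rintegral => //; last first.
  move=> t _; rewrite patchE; case: ifPn => [|_]; last exact: gamma_density_ge0.
  by rewrite inE/= in_itv/=; exact: cG.
- exact: L1_gamma_density.
- apply/L1_restrict => //; apply: measurable_bounded_integrable => //=.
    by rewrite lebesgue_measure_itv/=; case: ifP => // _; rewrite -EFinB ltry.
  exists `|c|; split => // M CM t _ /=; exact: ltW.
Qed.

Lemma Gamma_gt0 x : 0 < x -> 0 < Gamma x.
Proof.
move=> x0; apply: (@lt_le_trans _ _ (Num.min 1 (2 `^ (x - 1)) * expR (- 2))).
  by rewrite mulr_gt0 ?expR_gt0// lt_min ltr01 powR_gt0.
apply: (Gamma_lower_bound _ _ 1) => // t /andP[t1 t2].
have t0 : 0 <= t by exact: le_trans t1.
apply: ler_pM; rewrite ?expR_ge0//.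
- rewrite /pw t0; have [x1|x1] := leP 1 x.
    rewrite ge_min; apply/orP; left.
    apply: (@le_trans _ _ (1 `^ (x - 1))); first by rewrite powR1.
    by rewrite ge0_ler_powR ?nnegrE// subr_ge0.
  rewrite ge_min; apply/orP; right.
  rewrite -(opprB 1 x) !powRN lef_pV2 ?posrE ?powR_gt0//; last exact: lt_le_trans t1.
  by rewrite ge0_ler_powR ?nnegrE//; lra.
- by rewrite ler_expR; lra.
Qed.

(** As [A] is arbitrary, [Gamma (n al + 1)] outgrows every geometric sequence
    in [n], which gives the Mittag-Leffler series an infinite radius of
    convergence. *)
Lemma Gamma_ge x A : 0 <= x -> 0 <= A -> A `^ x * expR (- (A + 1)) <= Gamma (x + 1).
Proof.
move=> x0 A0; apply: (Gamma_lower_bound _ _ A); first by rewrite ltr_wpDl.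
move=> t /andP[At tA].
have t0 : 0 <= t by exact: le_trans At.
rewrite /gamma_density addrK /pw t0 ler_pM ?powR_ge0 ?expR_ge0//.
  by rewrite ge0_ler_powR ?nnegrE.
by rewrite ler_expR; lra.
Qed.

End Euler_integrals.

Section Beta_integral.
Context {R : realType}.
Notation mu := (@lebesgue_measure R).
Implicit Types x y t : R.

Local Open Scope ereal_scope.

Lemma measurable_pw_conv_l x y (t : R) :
  measurable_fun setT (fun r => (pw x r * pw y (t - r))%:E).
Proof.
apply/measurable_EFinP; apply: measurable_funM; first exact: measurable_pw.
apply: measurableT_comp; first exact: measurable_pw.
exact: measurable_funB.
Qed.

Lemma pw_conv_scaling x y (t : R) : (0 < t)%R ->
  \int[mu]_r (pw x r * pw y (t - r))%:E =
  (t `^ (x + y + 1))%:E * \int[mu]_r (pw x r * pw y (1 - r))%:E.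
Proof.
move=> t0.
have H0 a b (s : R) : (forall r, 0 <= (pw a r * pw b (s - r))%:E).
  by move=> r; rewrite lee_fin mulr_ge0 ?pw_ge0.
have mg s : measurable_fun setT (fun r => (pw x (t * r + 0) * pw y (s - (t * r + 0)))%:E).
  have ma : measurable_fun setT (fun r : R => t * r + 0)%R.
    by apply: measurable_funD => //; exact: measurable_funM.
  exact: (measurableT_comp (measurable_pw_conv_l x y s) ma).
have aff := ge0_integral_affine t 0%R (fun r => (pw x r * pw y (t - r))%:E)
  t0 (measurable_pw_conv_l x y t) (H0 x y t).
have tx0 : 0 <= (t `^ (x + y + 1))%:E by rewrite lee_fin powR_ge0.
have t0E : 0 <= t%:E by rewrite lee_fin ltW.
have Zl1 := @ge0_integralZl _ _ _ mu _ measurableT _ (measurable_pw_conv_l x y 1%R)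
  _ (fun r _ => H0 x y 1%R r) tx0.
have Zl2 := @ge0_integralZl _ _ _ mu _ measurableT _ (mg t)
  _ (fun r _ => H0 x y t (t * r + 0)%R) t0E.
rewrite aff -Zl2 -Zl1; apply: eq_integral => r _.
rewrite addr0 -!EFinM; congr EFin.
rewrite (_ : t - t * r = t * (1 - r))%R; last by ring.
have tE : (t `^ (x + y + 1) = t `^ x * t `^ y * t)%R.
  by rewrite !powRD ?(gt_eqF t0) ?implybT// powRr1// ltW.
by rewrite !pwM// tE; ring.
Qed.

Lemma pw_conv_nonpos x y (t : R) : (t <= 0)%R ->
  \int[mu]_r (pw x r * pw y (t - r))%:E = 0.
Proof.
move=> t0; rewrite -[RHS](integral_set1 (fun r => (pw x r * pw y (t - r))%:E) 0%R).
rewrite [RHS]integral_mkcond; apply: eq_integral => r _; rewrite patchE.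
case: ifPn => // /negP r0; rewrite /pw.
have [r00|] := leP 0%R r; last by rewrite mul0r.
have -> : (0 <= t - r)%R = false; last by rewrite mulr0.
apply/negbTE; rewrite -ltNge subr_lt0 (le_lt_trans t0)// lt_neqAle r00 andbT.
by apply/eqP => r0'; apply: r0; rewrite inE/= -r0'.
Qed.

(** Euler's identity, from computing the integral of [e^{-t}] against the
    convolution of two powers in both orders. *)
Lemma Gamma_mul_Beta x y : (0 < x)%R -> (0 < y)%R -> (1 < x + y)%R ->
  (Gamma x * Gamma y)%:E =
  \int[mu]_r (pw (x - 1) r * pw (y - 1) (1 - r))%:E * (Gamma (x + y))%:E.
Proof.
move=> x0 y0 xy1.
set Bt := \int[mu]_r _.
have Bt0 : 0 <= Bt by apply: integral_ge0 => r _; rewrite lee_fin mulr_ge0 ?pw_ge0.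
pose K (z : R * R) := (expR (- z.1) * (pw (x - 1) z.2 * pw (y - 1) (z.1 - z.2)))%:E.
have mK : measurable_fun setT K.
  apply/measurable_EFinP; apply: measurable_funM.
    by apply: measurableT_comp => //; exact: measurable_funN.
  apply: measurable_funM.
    by apply: measurableT_comp => //; exact: measurable_pw.
  apply: measurableT_comp; first exact: measurable_pw.
  by apply: measurable_funB.
have K0 z : 0 <= K z by rewrite lee_fin !mulr_ge0 ?expR_ge0 ?pw_ge0.
have := @fubini_tonelli _ _ _ _ R mu mu K mK K0.
rewrite [X in X = _ -> _](_ : _ = Bt * (Gamma (x + y))%:E); last first.
  rewrite -(Gamma_fin _ (addr_gt0 x0 y0)) -ge0_integralZl//; last 2 first.
    by apply/measurable_EFinP; exact: measurable_gamma_density.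
    by move=> t _; rewrite lee_fin gamma_density_ge0.
  apply: eq_integral => t _.
  rewrite /K/=; under eq_integral do rewrite EFinM.
  rewrite ge0_integralZl//; last 2 first.
  - exact: (measurable_pw_conv_l _ _ _).
  - by move=> r _; rewrite lee_fin mulr_ge0 ?pw_ge0.
  have [t0|t0] := leP t 0%R.
    rewrite pw_conv_nonpos// mule0 /gamma_density /pw.
    case: ifPn => [t0'|]; last by rewrite mul0r mule0.
    have -> : t = 0%R by apply/eqP; rewrite eq_le t0.
    rewrite powR0; first by rewrite mul0r mule0.
    by rewrite subr_eq0 gt_eqF.
  rewrite pw_conv_scaling// -/Bt /gamma_density /pw ltW//.
  rewrite muleA muleC; congr (_ * _).
  rewrite -EFinM mulrC; congr (_ `^ _ * _)%:E; ring.
move=> ->; rewrite EFinM -(Gamma_fin _ x0).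
rewrite muleC -ge0_integralZl//; last 3 first.
- by apply/measurable_EFinP; exact: measurable_gamma_density.
- by move=> t _; rewrite lee_fin gamma_density_ge0.
- by rewrite lee_fin ltW// Gamma_gt0.
apply: eq_integral => r _; rewrite /K/=.
rewrite -(Gamma_fin _ y0) muleC -ge0_integralZl//; last 3 first.
- by apply/measurable_EFinP; exact: measurable_gamma_density.
- by move=> t _; rewrite lee_fin gamma_density_ge0.
- by rewrite lee_fin gamma_density_ge0.
rewrite (ge0_integral_affine 1%R (- r)%R)//; last 2 first.
- apply: measurable_funeM; apply/measurable_EFinP; exact: measurable_gamma_density.
- by move=> t; rewrite -EFinM lee_fin mulr_ge0 ?gamma_density_ge0.
rewrite mul1e; apply: eq_integral => t _; rewrite mul1r -EFinM; congr EFin.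
have -> : (expR (- t) = expR (- r) * expR (- (t - r)))%R.
  by rewrite -expRD; congr expR; ring.
by rewrite /gamma_density; ring.
Qed.

(** The condition [1 < x + y] is what makes the right-hand side vanish at
    [t = 0], as the left-hand side does. *)
Lemma pw_conv x y (t : R) : (0 < x)%R -> (0 < y)%R -> (1 < x + y)%R ->
  \int[mu]_r (pw (x - 1) r * pw (y - 1) (t - r))%:E =
  (pw (x + y - 1) t * (Gamma x * Gamma y / Gamma (x + y)))%:E.
Proof.
move=> x0 y0 xy1; have [t0|t0] := leP t 0%R.
  rewrite pw_conv_nonpos// /pw; case: ifPn => [t0'|]; last by rewrite mul0r.
  have -> : t = 0%R by apply/eqP; rewrite eq_le t0.
  by rewrite powR0 ?mul0r// subr_eq0 gt_eqF.
rewrite pw_conv_scaling// /pw ltW// EFinM.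
congr (_ * _); first by congr (_ `^ _)%:E; ring.
have G0 : (0 < Gamma (x + y))%R by apply: Gamma_gt0; rewrite addr_gt0.
rewrite EFinM Gamma_mul_Beta// -muleA -EFinM divff ?mule1//.
by rewrite gt_eqF.
Qed.

End Beta_integral.

(** * The Riemann-Liouville integral *)

Section Fractional_integral.
Context {R : realType}.
Notation mu := (@lebesgue_measure R).
Implicit Types (al a t : R) (u v : R -> R).

Definition bounded_measurable v : Prop :=
  measurable_fun setT v /\ exists C, forall x, `|v x| <= C.

Lemma bounded_measurableD u v : bounded_measurable u -> bounded_measurable v ->
  bounded_measurable (fun x => u x + v x).
Proof.
move=> [mu_ [C uC]] [mv [D vD]]; split; first exact: measurable_funD.
by exists (C + D) => x; rewrite (le_trans (ler_normD _ _))// lerD.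
Qed.

Lemma bounded_measurableZ c v : bounded_measurable v ->
  bounded_measurable (fun x => c * v x).
Proof.
move=> [mv [C vC]]; split; first exact: measurable_funM.
by exists (`|c| * C) => x; rewrite normrM ler_wpM2l.
Qed.

Lemma bounded_measurableB u v : bounded_measurable u -> bounded_measurable v ->
  bounded_measurable (fun x => u x - v x).
Proof.
move=> bu bv; have := bounded_measurableD _ _ bu (bounded_measurableZ (-1) _ bv).
by under [X in bounded_measurable X -> _]eq_fun do rewrite mulN1r.
Qed.

Lemma bounded_measurable_norm v : bounded_measurable v ->
  bounded_measurable (fun x => `|v x|).
Proof.
move=> [mv [C vC]]; split; first exact: measurableT_comp.
by exists C => x; rewrite normr_id.
Qed.

Lemma bounded_measurable_restrict (D : set R) v C : measurable D ->
  measurable_fun setT v -> (forall x, D x -> `|v x| <= C) ->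
  bounded_measurable (v \_ D).
Proof.
move=> mD mv vC; split.
  apply/(measurable_restrictT _ mD); exact: (measurable_funS measurableT).
exists `|C| => x; rewrite patchE; case: ifPn => [|_].
  by rewrite inE => Dx; rewrite (le_trans (vC _ Dx))// ler_norm.
by rewrite normr0.
Qed.

Lemma restrict_itvE a v x :
  (v \_ `[0, a]) x = if 0 <= x <= a then v x else 0.
Proof.
rewrite patchE; case: ifPn => [|]; first by rewrite inE/= in_itv/= => ->.
by rewrite notin_setE/= in_itv/= => /negP/negbTE ->.
Qed.

(** The Riemann-Liouville kernel cut off at [a]: a convolution with it is the
    fractional integral at times up to [a] of functions that vanish at
    negative times, and the cut-off makes it integrable on the line. *)
Definition rl_kernel al a : R -> R :=
  (fun r => pw (al - 1) r / Gamma al) \_ `[0, a].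

Definition frac_int al a v t : R := \int[mu]_r (rl_kernel al a r * v (t - r)).

Lemma measurable_rl_kernel al a : measurable_fun setT (rl_kernel al a).
Proof.
rewrite /rl_kernel; apply/(measurable_restrictT _ (measurable_itv _)).
apply: (measurable_funS measurableT) => //.
by apply: measurable_funM => //; exact: measurable_pw.
Qed.

Lemma rl_kernel_ge0 al a r : 0 < al -> 0 <= rl_kernel al a r.
Proof.
move=> al0; rewrite /rl_kernel restrict_itvE; case: ifP => // _.
by rewrite divr_ge0 ?pw_ge0// ltW// Gamma_gt0.
Qed.

Lemma rl_kernel_neg al a r : r < 0 -> rl_kernel al a r = 0.
Proof.
move=> r0; by rewrite /rl_kernel restrict_itvE (lt_geF r0).
Qed.

Lemma L1_rl_kernel al a : 0 < al -> L1 (rl_kernel al a).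
Proof.
move=> al0; apply: (L1_dominated _ (fun r => expR a / Gamma al * gamma_density al r)).
- exact: measurable_rl_kernel.
- move=> r; rewrite ger0_norm ?rl_kernel_ge0//.
  have G0 := Gamma_gt0 _ al0.
  rewrite /rl_kernel restrict_itvE; case: ifPn => [/andP[r0 ra]|_]; last first.
    apply: mulr_ge0; last exact: gamma_density_ge0.
    by rewrite divr_ge0 ?expR_ge0 ?(ltW G0).
  rewrite /gamma_density.
  rewrite [leLHS](_ : _ = pw (al - 1) r / Gamma al * 1); last by ring.
  rewrite [leRHS](_ : _ = pw (al - 1) r / Gamma al * (expR a * expR (- r))); last by ring.
  rewrite ler_wpM2l ?divr_ge0 ?pw_ge0//; first exact: ltW.
  by rewrite -expRD -expR0 ler_expR subr_ge0.
- by apply: L1Z; exact: L1_gamma_density.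
Qed.

Lemma L1_frac_int al a v t : 0 < al -> bounded_measurable v ->
  L1 (fun r => rl_kernel al a r * v (t - r)).
Proof.
move=> al0 [mv [C vC]]; apply: (L1M_bounded C); first exact: L1_rl_kernel.
  by apply: measurableT_comp => //; exact: measurable_funB.
by move=> x; exact: vC.
Qed.

Lemma frac_intB al a u v t : 0 < al -> bounded_measurable u -> bounded_measurable v ->
  frac_int al a (fun x => u x - v x) t = frac_int al a u t - frac_int al a v t.
Proof.
move=> al0 bu bv; rewrite -RintegralB//; [|exact: L1_frac_int..].
by apply: eq_Rintegral => r _; rewrite mulrBr.
Qed.

Lemma frac_intD al a u v t : 0 < al -> bounded_measurable u -> bounded_measurable v ->
  frac_int al a (fun x => u x + v x) t = frac_int al a u t + frac_int al a v t.
Proof.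
move=> al0 bu bv; rewrite -RintegralD//; [|exact: L1_frac_int..].
by apply: eq_Rintegral => r _; rewrite mulrDr.
Qed.

Lemma frac_intZ al a c v t : 0 < al -> bounded_measurable v ->
  frac_int al a (fun x => c * v x) t = c * frac_int al a v t.
Proof.
move=> al0 bv; rewrite -RintegralZl//; last exact: L1_frac_int.
by apply: eq_Rintegral => r _; rewrite mulrCA.
Qed.

Lemma eq_frac_int al a u v t : (forall s, s <= t -> u s = v s) ->
  frac_int al a u t = frac_int al a v t.
Proof.
move=> uv; apply: eq_Rintegral => r _; have [r0|r0] := leP 0 r.
  by rewrite uv// gerBl.
by rewrite rl_kernel_neg// !mul0r.
Qed.

Lemma le_frac_int al a u v t : 0 < al -> bounded_measurable u ->
  bounded_measurable v -> (forall s, s <= t -> u s <= v s) ->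
  frac_int al a u t <= frac_int al a v t.
Proof.
move=> al0 bu bv uv; apply: le_Rintegral => //; [exact: L1_frac_int..|].
move=> r _; have [r0|r0] := leP 0 r; last by rewrite rl_kernel_neg// !mul0r.
by rewrite ler_wpM2l ?rl_kernel_ge0// uv// gerBl.
Qed.

Lemma frac_int_ge0 al a v t : 0 < al -> (forall s, 0 <= v s) ->
  0 <= frac_int al a v t.
Proof.
by move=> al0 v0; apply: Rintegral_ge0 => r _; rewrite mulr_ge0 ?rl_kernel_ge0.
Qed.

Lemma norm_frac_int al a v t : 0 < al -> bounded_measurable v ->
  `|frac_int al a v t| <= frac_int al a (fun x => `|v x|) t.
Proof.
move=> al0 bv; apply: (le_trans (le_normr_Rintegral _ (L1_frac_int al a v t al0 bv))) => //.
rewrite le_eqVlt; apply/orP; left; apply/eqP; apply: eq_Rintegral => r _.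
by rewrite normrM ger0_norm ?rl_kernel_ge0.
Qed.

Lemma frac_int_cst al a c t : 0 < al ->
  frac_int al a (cst c) t = c * \int[mu]_r rl_kernel al a r.
Proof.
move=> al0; rewrite -RintegralZl//; last exact: L1_rl_kernel.
by apply: eq_Rintegral => r _; rewrite mulrC.
Qed.

Lemma bounded_measurable_cst c : bounded_measurable (cst c).
Proof. by split => //; exists `|c|. Qed.

Lemma frac_int_sum al a (N : nat) (c : nat -> R) (v : nat -> R -> R) t : 0 < al ->
  (forall n, bounded_measurable (v n)) ->
  frac_int al a (fun x => \sum_(n < N) c n * v n x) t =
  \sum_(n < N) c n * frac_int al a (v n) t.
Proof.
move=> al0 bv.
suff [] : bounded_measurable (fun x => \sum_(n < N) c n * v n x) /\
  frac_int al a (fun x => \sum_(n < N) c n * v n x) t =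
  \sum_(n < N) c n * frac_int al a (v n) t by [].
elim: N => [|N [IHb IH]].
  split; last first.
    rewrite big_ord0 (_ : (fun x => _) = cst 0) ?frac_int_cst ?mul0r//.
    by apply/funext => x; rewrite big_ord0.
  rewrite (_ : (fun x => _) = cst 0); first exact: bounded_measurable_cst.
  by apply/funext => x; rewrite big_ord0.
have E : (fun x => \sum_(n < N.+1) c n * v n x) =
    (fun x => (\sum_(n < N) c n * v n x) + c N * v N x).
  by apply/funext => x; rewrite big_ord_recr.
have bN : bounded_measurable (fun x => c N * v N x) by exact: bounded_measurableZ.
split; first by rewrite E; exact: bounded_measurableD.
by rewrite E frac_intD// IH frac_intZ// big_ord_recr.
Qed.

End Fractional_integral.

(** * The Mittag-Leffler function *)

Section Mittag_Leffler.
Context {R : realType}.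
Notation mu := (@lebesgue_measure R).
Implicit Types (al a t m z : R).

Definition ml_term al z (n : nat) : R := z ^+ n / Gamma (n%:R * al + 1).

Lemma GammaS_gt0 al (n : nat) : 0 < al -> 0 < Gamma (n%:R * al + 1).
Proof. by move=> al0; apply: Gamma_gt0; rewrite ltr_wpDl// mulr_ge0// ltW. Qed.

Lemma ml_term_bound al Z : 0 < al -> 0 <= Z -> exists2 C : R, 0 <= C &
  forall (n : nat) z, `|z| <= Z -> `|ml_term al z n| <= C * 2^-1 ^+ n.
Proof.
move=> al0 Z0; pose A := (2 * Z + 1) `^ al^-1.
(* this [A] gives A ^ (n al) = (2 Z + 1)^n, hence a ratio of at most 1/2 *)
exists (expR (A + 1)); first exact: expR_ge0.
move=> n z zZ; have Z1 : 0 < 2 * Z + 1 by rewrite ltr_wpDl// mulr_ge0.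
have A0 : 0 <= A by exact: powR_ge0.
have n0 : 0 <= n%:R * al by rewrite mulr_ge0// ltW.
have := Gamma_ge _ _ n0 A0.
have -> : A `^ (n%:R * al) = (2 * Z + 1) ^+ n.
  rewrite /A -powRrM mulrCA mulVf ?gt_eqF// mulr1 powR_mulrn//; exact: ltW.
move=> GA; have G0 := GammaS_gt0 al n al0.
rewrite /ml_term normrM normfV (gtr0_norm G0) normrX ler_pdivrMr//.
apply: (@le_trans _ _ (expR (A + 1) * 2^-1 ^+ n * ((2 * Z + 1) ^+ n * expR (- (A + 1))))); last first.
  by rewrite ler_wpM2l// mulr_ge0 ?expR_ge0// exprn_ge0// invr_ge0.
have eE : expR (A + 1) * expR (- (A + 1)) = 1 by rewrite -expRD subrr expR0.
rewrite [X in _ <= X](_ : _ = (2^-1 * (2 * Z + 1)) ^+ n); last first.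
  have alg (x y u v : R) : x * y * (u * v) = x * v * (y * u) by ring.
  by rewrite exprMn alg eE mul1r.
have zh : `|z| <= 2^-1 * (2 * Z + 1) by move: zZ; lra.
by rewrite lerXn2r ?nnegrE// (le_trans _ zh).
Qed.

Lemma norm_half_lt1 : `|2^-1| < 1 :> R.
Proof. by rewrite ger0_norm ?invr_ge0// invf_lt1// ltr1n. Qed.

Lemma ml_tail al Z : 0 < al -> 0 <= Z -> exists2 C : R, 0 <= C &
  forall (N : nat) z, `|z| <= Z ->
  `|mittag_leffler al z - \sum_(n < N) ml_term al z n| <= C * 2^-1 ^+ N.
Proof.
move=> al0 Z0; have [C C0 HC] := ml_term_bound al Z al0 Z0.
exists (C * 2) => [|N z zZ]; first by rewrite mulr_ge0.
have h1 := norm_half_lt1.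
have cvgE : cvgn (series (ml_term al z)).
  apply: normed_cvg; apply: (series_le_cvg _ _ _ (@is_cvg_geometric_series _ C _ h1)).
  - by move=> n; exact: normr_ge0.
  - by move=> n; rewrite /= mulr_ge0 ?exprn_ge0 ?invr_ge0//; exact: C0.
  - by move=> n; exact: HC.
have -> : mittag_leffler al z = limn (series (ml_term al z)) by [].
have H : (fun M => series (ml_term al z) M - \sum_(n < N) ml_term al z n) @ \oo -->
   limn (series (ml_term al z)) - \sum_(n < N) ml_term al z n.
  by apply: cvgB => //; exact: cvg_cst.
have Hn := cvg_norm H.
apply: (cvgr_to_le (Hn _)); near=> M.
have NM : (N <= M)%N by near: M; exact: nbhs_infty_ge.
rewrite -(big_mkord xpredT (ml_term al z)) -/(series (ml_term al z) N).
rewrite sub_series NM (le_trans (ler_norm_sum _ _ _))//.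
apply: (@le_trans _ _ (\sum_(N <= k < M) C * 2^-1 ^+ k)).
  by apply: ler_sum => k _; exact: HC.
rewrite -(subnKC NM) -mulr_sumr geometric_partial_tail -mulrA ler_wpM2l//.
apply: le_trans (geometric_le_lim _ _ _ h1) _ => //.
by rewrite (_ : 1 - 2^-1 = 2^-1) ?invrK 1?mulrC//; lra.
Unshelve. all: by end_near.
Qed.

(** Used to pass to the limit in relations that partial sums or iterates satisfy
    up to a geometrically small error. *)
Lemma eq0_geometric_bound (q x K : R) : `|q| < 1 ->
  (forall N : nat, `|x| <= K * q ^+ N) -> x = 0.
Proof.
move=> q1 xK; apply/normr0_eq0/le_anti; rewrite normr_ge0 andbT.
by apply: (cvgr_to_ge (cvg_geometric K q1)); apply: nearW => N; exact: xK.
Qed.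

Lemma mittag_leffler_le al z1 z2 : 0 < al -> 0 <= z1 <= z2 ->
  mittag_leffler al z1 <= mittag_leffler al z2.
Proof.
move=> al0 /andP[z10 z12].
have [C C0 HC] := ml_tail al z2 al0 (le_trans z10 z12).
rewrite -subr_le0 leNgt; apply/negP => d0.
have : mittag_leffler al z1 - mittag_leffler al z2 = 0.
  apply: (eq0_geometric_bound 2^-1 _ (C + C) norm_half_lt1) => N; rewrite gtr0_norm//.
  have := HC N z1; rewrite ger0_norm// => /(_ z12).
  have := HC N z2; rewrite ger0_norm ?(le_trans z10)// => /(_ (lexx _)).
  rewrite ler_norml => /andP[+ _]; rewrite ler_norml => + /andP[_].
  have : \sum_(n < N) ml_term al z1 n <= \sum_(n < N) ml_term al z2 n.
    apply: ler_sum => n _; rewrite ler_wpM2r ?invr_ge0 ?(ltW (GammaS_gt0 _ _ _))//.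
    by rewrite lerXn2r ?nnegrE// (le_trans z10).
  by lra.
by move=> d0'; rewrite d0' ltxx in d0.
Qed.

Lemma mittag_leffler_ge0 al z : 0 < al -> 0 <= z -> 0 <= mittag_leffler al z.
Proof.
move=> al0 z0; have [C C0 HC] := ml_tail al z al0 z0.
rewrite leNgt; apply/negP => d0.
have : mittag_leffler al z = 0.
  apply: (eq0_geometric_bound 2^-1 _ (C) norm_half_lt1) => N; rewrite ltr0_norm//.
  have := HC N z; rewrite ger0_norm// => /(_ (lexx _)).
  rewrite ler_norml => /andP[+ _].
  have : 0 <= \sum_(n < N) ml_term al z n.
    by apply: sumr_ge0 => n _; rewrite divr_ge0 ?exprn_ge0// ltW// GammaS_gt0.
  by lra.
by move=> d0'; rewrite d0' ltxx in d0.
Qed.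

(** The function [t |-> E_al(m t^al)] on [0, a], extended by 0: the solution
    of the scalar fractional relaxation equation.  Negative [m] give the
    memory kernel, positive [m] the weights for the norms. *)
Definition ml_fun al a m : R -> R :=
  (fun t => mittag_leffler al (m * t `^ al)) \_ `[0, a].

Definition ml_power al a (n : nat) : R -> R :=
  (fun t => pw (n%:R * al) t / Gamma (n%:R * al + 1)) \_ `[0, a].

Lemma bounded_measurable_ml_power al a n : 0 < al -> bounded_measurable (ml_power al a n).
Proof.
move=> al0; have G0 := GammaS_gt0 al n al0.
apply: (bounded_measurable_restrict _ _ (a `^ (n%:R * al) / Gamma (n%:R * al + 1))) => //.
  by apply: measurable_funM => //; exact: measurable_pw.
move=> t /=; rewrite in_itv/= => /andP[t0 ta].
have G0' := ltW G0.
have na : 0 <= n%:R * al by rewrite mulr_ge0// ltW.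
rewrite normrM normfV (gtr0_norm G0) ler_wpM2r ?invr_ge0//.
have a0 := le_trans t0 ta.
by rewrite /pw t0 ger0_norm ?powR_ge0// ge0_ler_powR ?nnegrE.
Qed.

Lemma ml_fun_tail al a m : 0 < al -> exists2 C : R, 0 <= C &
  forall (N : nat) t,
  `|ml_fun al a m t - \sum_(n < N) m ^+ n * ml_power al a n t| <= C * 2^-1 ^+ N.
Proof.
move=> al0; have [|C C0 HC] := ml_tail al (`|m| * a `^ al) al0.
  by rewrite mulr_ge0 ?powR_ge0.
exists C => // N t; rewrite /ml_fun /ml_power.
rewrite restrict_itvE; under eq_bigr do rewrite restrict_itvE.
case: ifP => [/andP[t0 ta]|_]; last first.
  rewrite big1 ?subrr ?normr0 ?mulr_ge0 ?exprn_ge0 ?invr_ge0//.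
  by move=> n _; rewrite mulr0.
have zZ : `|m * t `^ al| <= `|m| * a `^ al.
  rewrite normrM ler_wpM2l// ger0_norm ?powR_ge0//.
  have a0 := le_trans t0 ta.
  by rewrite ge0_ler_powR ?nnegrE// ltW.
have := HC N _ zZ; congr (`| _ - _ | <= _); apply: eq_bigr => n _.
rewrite /ml_term /pw t0 exprMn mulrA.
have -> : t `^ (n%:R * al) = (t `^ al) ^+ n; last by [].
by rewrite -[RHS]powR_mulrn ?powR_ge0// -powRrM mulrC.
Qed.

Lemma bounded_measurable_ml_fun al a m : 0 < al -> bounded_measurable (ml_fun al a m).
Proof.
move=> al0; have [C C0 HC] := ml_fun_tail al a m al0.
split; last first.
  exists C => t; have := HC 0%N t.
  by rewrite big_ord0 subr0 expr0 mulr1.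
apply: (@measurable_fun_cvg _ _ _ _
  (fun N t => \sum_(n < N) m ^+ n * ml_power al a n t)).
  move=> N; apply: measurable_sum => n; apply: measurable_funM => //.
  by have [] := bounded_measurable_ml_power al a n al0.
move=> t _; apply/cvgrPdist_le => /= e e0.
have h1 := norm_half_lt1.
have /cvgrPdist_le/(_ e e0) := cvg_geometric C h1.
apply: filterS => N; rewrite sub0r normrN => H.
by rewrite (le_trans (HC N t))// (le_trans _ H)//= ler_norm.
Qed.

Lemma frac_int_ml_power al a n t : 0 < al -> t <= a ->
  frac_int al a (ml_power al a n) t = ml_power al a n.+1 t.
Proof.
move=> al0 ta; have G0 := GammaS_gt0 al n al0; have G1 := GammaS_gt0 al n.+1 al0.
have Ga := Gamma_gt0 al al0.
have y0 : 0 < n%:R * al + 1 by rewrite ltr_wpDl// mulr_ge0// ltW.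
have xy1 : 1 < al + (n%:R * al + 1) by rewrite addrA ltrDr ltr_pwDl// mulr_ge0// ltW.
have := pw_conv al (n%:R * al + 1) t al0 y0 xy1.
have E1 : al + (n%:R * al + 1) = n.+1%:R * al + 1 by rewrite -natr1; ring.
rewrite E1 => E.
rewrite /frac_int.
transitivity (\int[mu]_r ((Gamma al)^-1 * (Gamma (n%:R * al + 1))^-1 *
    (pw (al - 1) r * pw (n%:R * al + 1 - 1) (t - r)))).
  apply: eq_Rintegral => r _; rewrite addrK /rl_kernel /ml_power !restrict_itvE.
  have [r0|r0]/= := leP 0 r; last by rewrite [in RHS]/pw (lt_geF r0) !mul0r mulr0.
  rewrite subr_ge0; have [rt|rt]/= := leP r t; last first.
    by rewrite [X in _ = _ * (_ * X)]/pw subr_ge0 (lt_geF rt) !mulr0.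
  rewrite (le_trans rt ta) lerBlDr (le_trans ta) ?lerDl//; by ring.
have EF : ((\int[mu]_r (pw (al - 1) r * pw (n%:R * al + 1 - 1) (t - r)))%:E =
    \int[mu]_r (pw (al - 1) r * pw (n%:R * al + 1 - 1) (t - r))%:E)%E.
  by rewrite /Rintegral fineK// E.
rewrite RintegralZl//; last first.
  apply/integrableP; split; first exact: (measurable_pw_conv_l _ _ _).
  apply: (@le_lt_trans _ _ (\int[mu]_r (pw (al - 1) r * pw (n%:R * al + 1 - 1) (t - r))%:E)%E).
    rewrite le_eqVlt; apply/orP; left; apply/eqP; apply: eq_integral => r _ /=.
    by rewrite ger0_norm// mulr_ge0 ?pw_ge0.
  by rewrite E ltry.
rewrite /Rintegral E/= addrK /ml_power restrict_itvE ta andbT.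
have -> : (if 0 <= t then pw (n.+1%:R * al) t / Gamma (n.+1%:R * al + 1) else 0)
   = pw (n.+1%:R * al) t / Gamma (n.+1%:R * al + 1).
  by case: ifPn => // /negbTE t0; rewrite /pw t0 mul0r.
have alg (x y z p : R) : x != 0 -> y != 0 ->
    x^-1 * y^-1 * (p * (x * y / z)) = p / z.
  by move=> x0 y0'; rewrite -invfM mulrCA mulKf ?mulf_neq0.
by rewrite alg// gt_eqF.
Qed.

Lemma ml_power0 al a t : ml_power al a 0 t = (0 <= t <= a)%R%:R.
Proof.
rewrite /ml_power restrict_itvE; case: ifP => // /andP[t0 ta].
by rewrite /pw t0 mul0r powRr0 add0r Gamma1 divr1.
Qed.

(** Fractional integration sends each term of the series to the next one, up to
    the factor [m]; only the constant term is lost. *)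
Lemma frac_int_ml_fun al a m t : 0 < al -> t <= a ->
  m * frac_int al a (ml_fun al a m) t = ml_fun al a m t - (0 <= t <= a)%R%:R.
Proof.
move=> al0 ta; have [C C0 HC] := ml_fun_tail al a m al0.
pose S N t := \sum_(n < N) m ^+ n * ml_power al a n t.
have bS N : bounded_measurable (S N).
  rewrite /S; elim: N => [|N IH].
    rewrite (_ : (fun x => _) = cst 0); first exact: bounded_measurable_cst.
    by apply/funext => x; rewrite big_ord0.
  rewrite (_ : (fun x => _) = (fun t => S N t + m ^+ N * ml_power al a N t)).
    apply: bounded_measurableD => //; apply: bounded_measurableZ.
    exact: bounded_measurable_ml_power.
  by apply/funext => x; rewrite big_ord_recr.
have be := bounded_measurable_ml_fun al a m al0.
have SN N : m * frac_int al a (S N) t = S N.+1 t - (0 <= t <= a)%R%:R.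
  rewrite /S frac_int_sum//; last by move=> n; exact: bounded_measurable_ml_power.
  rewrite mulr_sumr big_ord_recl expr0 mul1r ml_power0 addrAC subrr add0r.
  by apply: eq_bigr => n _; rewrite frac_int_ml_power// mulrA -exprS.
pose K0 := \int[mu]_r rl_kernel al a r.
have K00 : 0 <= K0 by apply: Rintegral_ge0 => r _; rewrite rl_kernel_ge0.
apply/eqP; rewrite -subr_eq0; apply/eqP.
apply: (eq0_geometric_bound 2^-1 _ (`|m| * (C * K0) + C) norm_half_lt1) => N.
rewrite (_ : _ - _ = m * (frac_int al a (ml_fun al a m) t - frac_int al a (S N) t)
   - (ml_fun al a m t - S N.+1 t)); last by rewrite mulrBr SN; ring.
rewrite (le_trans (ler_normB _ _))// mulrDl lerD//.
  rewrite normrM -mulrA ler_wpM2l// -frac_intB// mulrAC.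
  apply: (le_trans (norm_frac_int _ _ _ _ al0 _)); first exact: bounded_measurableB.
  rewrite -(frac_int_cst al a _ t)//; apply: le_frac_int => //.
  - by apply: bounded_measurable_norm; exact: bounded_measurableB.
  - exact: bounded_measurable_cst.
  - by move=> s _; exact: HC.
rewrite (le_trans (HC _ _))// ler_wpM2l// exprS ler_piMl ?exprn_ge0 ?invr_ge0//.
by rewrite invf_le1// ler1n.
Qed.

End Mittag_Leffler.

(** * Weighted estimates and uniqueness for Volterra equations *)

Section Volterra.
Context {R : realType}.
Notation mu := (@lebesgue_measure R).
Implicit Types (al a t m : R) (u v : R -> R).

Lemma ml_fun_ge0 al a m t : 0 < al -> 0 <= m -> 0 <= ml_fun al a m t.
Proof.
move=> al0 m0; rewrite /ml_fun restrict_itvE; case: ifP => // _.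
by rewrite mittag_leffler_ge0// mulr_ge0 ?powR_ge0.
Qed.

Lemma ml_fun_ge1 al a m t : 0 < al -> 0 <= m -> 0 <= t <= a -> 1 <= ml_fun al a m t.
Proof.
move=> al0 m0 ta; rewrite -subr_ge0.
have := frac_int_ml_fun al a m t al0; rewrite ta.
have /andP[_ ta'] := ta.
move=> /(_ ta') <-; rewrite mulr_ge0// frac_int_ge0// => s.
exact: ml_fun_ge0.
Qed.

Lemma ml_fun_le al a m s t : 0 < al -> 0 <= m -> s <= t -> t <= a ->
  ml_fun al a m s <= ml_fun al a m t.
Proof.
move=> al0 m0 st ta; have [s0|s0] := leP 0 s; last first.
  by rewrite [leLHS]restrict_itvE (lt_geF s0)/= ml_fun_ge0.
rewrite /ml_fun !restrict_itvE s0 (le_trans st ta) (le_trans s0 st) ta/=.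
apply: mittag_leffler_le => //; rewrite mulr_ge0 ?powR_ge0//=.
by rewrite ler_wpM2l// ge0_ler_powR ?nnegrE ?(ltW al0)// (le_trans s0).
Qed.

(** The weight [ml_fun al a m] is chosen for this estimate: in the norm it
    defines, fractional integration contracts by the factor [1 / m]. *)
Lemma norm_frac_int_weight al a m v N t : 0 < al -> 0 < m -> 0 <= N ->
  bounded_measurable v ->
  (forall s, s <= a -> `|v s| <= N * ml_fun al a m s) -> t <= a ->
  `|frac_int al a v t| <= N / m * ml_fun al a m t.
Proof.
move=> al0 m0 N0 bv vN ta.
have be := bounded_measurable_ml_fun al a m al0.
apply: (le_trans (norm_frac_int al a v t al0 bv)).
apply: (@le_trans _ _ (frac_int al a (fun s => N * ml_fun al a m s) t)).
  apply: le_frac_int => //; first exact: bounded_measurable_norm.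
    exact: bounded_measurableZ.
  by move=> s st; apply: vN; exact: le_trans ta.
rewrite frac_intZ// -mulrA ler_wpM2l// ler_pdivlMl//.
by rewrite frac_int_ml_fun// gerBl.
Qed.

(** In the norm weighted by [ml_fun al a m], with [m] so large that
    [C / m <= (1 - theta) / 2], each use of the inequality halves the bound on
    [u]. *)
Lemma Volterra_unique al a theta C u : 0 < al -> 0 <= theta < 1 -> 0 <= C ->
  bounded_measurable u -> (forall t, t < 0 -> u t = 0) ->
  (forall t, 0 <= t <= a ->
    `|u t| <= theta * `|u t| + C * frac_int al a (fun s => `|u s|) t) ->
  forall t, t <= a -> u t = 0.
Proof.
move=> al0 /andP[th0 th1] C0 bu u0 uC t ta.
have th1' : 0 < 1 - theta by rewrite subr_gt0.
pose m := 2 * C / (1 - theta) + 1.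
have m0 : 0 < m by rewrite ltr_wpDl// divr_ge0 ?mulr_ge0// ltW.
have [_ [N uN]] := bu.
have N0 : 0 <= N := le_trans (normr_ge0 _) (uN 0).
have H : forall (n : nat) s, s <= a -> `|u s| <= N * 2^-1 ^+ n * ml_fun al a m s.
  elim=> [|n IH] s sa.
    have [s0|s0] := leP 0 s; last first.
      by rewrite u0// normr0 mulr_ge0 ?ml_fun_ge0 ?expr0 ?mulr1// ltW.
    rewrite expr0 mulr1 (le_trans (uN s))// ler_peMr// ml_fun_ge1 ?s0//.
    exact: ltW.
  have E0 : 0 <= ml_fun al a m s by rewrite ml_fun_ge0// ltW.
  have Nn0 : 0 <= N * 2^-1 ^+ n by rewrite mulr_ge0// exprn_ge0// invr_ge0.
  have [s0|s0] := leP 0 s; last first.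
    by rewrite u0// normr0 !mulr_ge0 ?exprn_ge0 ?invr_ge0.
  have us := uC s; rewrite s0 sa in us.
  have us' := us isT.
  have := norm_frac_int_weight al a m (fun s => `|u s|) _ s al0 m0 Nn0
    (bounded_measurable_norm _ bu) _ sa.
  rewrite ger0_norm; last by rewrite frac_int_ge0.
  have IH' : forall s, s <= a -> `| `|u s| | <= N * 2^-1 ^+ n * ml_fun al a m s.
    by move=> r ra; rewrite normr_id; exact: IH.
  move=> /(_ IH') Hs.
  set e := ml_fun al a m s in E0 Hs *; set X := N * _ in Nn0 Hs *.
  have Cm : C / m <= (1 - theta) / 2.
    rewrite ler_pdivrMr// /m mulrDr mulr1.
    rewrite [X in _ <= X + _](_ : _ = C); last by field; exact: lt0r_neq0.
    by rewrite lerDl divr_ge0// ltW.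
  have CX : C * frac_int al a (fun s => `|u s|) s <= (1 - theta) / 2 * (X * e).
    apply: (@le_trans _ _ (C * (X / m * e))); first by rewrite ler_wpM2l.
    rewrite [leLHS](_ : _ = C / m * (X * e)); last by ring.
    by rewrite ler_wpM2r// mulr_ge0.
  have : (1 - theta) * `|u s| <= (1 - theta) / 2 * (X * e).
    by rewrite mulrBl mul1r lerBlDl (le_trans us')// lerD2l.
  rewrite -mulrA ler_pM2l// => /le_trans; apply.
  by rewrite le_eqVlt; apply/orP; left; apply/eqP; rewrite /X exprS; ring.
apply: (eq0_geometric_bound 2^-1 _ (N * ml_fun al a m t) norm_half_lt1) => n.
by rewrite mulrAC; exact: H.
Qed.

End Volterra.

(** * Lipschitz functions as primitives *)

Section Lipschitz_density.
Context {R : realType}.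
Notation mu := (@lebesgue_measure R).
Implicit Types (w : R -> R).

Lemma cumulative_of_continuous (f : R -> R) : nondecreasing f -> continuous f ->
  exists F : cumulative R R, F =1 f.
Proof.
move=> ndf cf.
pose F : cumulative R R := HB.pack f
  (isCumulative.Build R _ R f ndf (right_continuousW cf)).
by exists F.
Qed.

Lemma lebesgue_stieltjes_itv_oc (F : cumulative R R) x y : x <= y ->
  lebesgue_stieltjes_measure F `]x, y]%classic = (F y - F x)%:E.
Proof.
move=> xy; rewrite /lebesgue_stieltjes_measure /measure_extension/=.
by rewrite measurable_mu_extE/= ?wlength_itv_bnd//; exact: is_ocitv.
Qed.

Lemma lipschitz_continuous K w : (forall x y, `|w x - w y| <= K * `|x - y|) ->
  continuous w.
Proof.
move=> wK x; apply/cvgrPdist_le => /= e e0.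
have K0 : 0 <= K.
  by have := le_trans (normr_ge0 _) (wK 1 0); rewrite subr0 normr1 mulr1.
near=> y; rewrite (le_trans (wK _ _))//.
have : `|x - y| <= e / (K + 1).
  by near: y; apply: cvgr_dist_le; [exact: cvg_id|rewrite divr_gt0// ltr_wpDl].
rewrite ler_pdivlMr ?ltr_wpDl// => /(le_trans _); apply.
by rewrite mulrC ler_wpM2l// lerDl.
Unshelve. all: by end_near.
Qed.

(** [K x + w x] and [K x - w x] are nondecreasing, and their Stieltjes
    measures add up to [2 K] times Lebesgue measure; so the first one has a
    density, with values between 0 and [2 K]. *)
Lemma lipschitz_density K w a : 0 < K -> 0 <= a ->
  (forall x y, `|w x - w y| <= K * `|x - y|) ->
  exists h : R -> R, [/\ measurable_fun setT h, forall x, `|h x| <= K &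
    forall t, 0 <= t <= a -> w t = w 0 + \int[mu]_(s in `[0, t]) h s].
Proof.
move=> K0 a0 wK.
have cw := lipschitz_continuous K w wK.
have cK : continuous (fun x : R => K * x).
  by move=> x; apply: cvgM; [exact: cvg_cst|exact: cvg_id].
have [F1 F1E] : exists F : cumulative R R, F =1 (fun x => K * x + w x).
  apply: cumulative_of_continuous; last by move=> x; apply: cvgD; [exact: cK|exact: cw].
  move=> x y xy; rewrite -subr_ge0.
  have := wK y x; rewrite (@ger0_norm _ (y - x)) ?subr_ge0// ler_norml => /andP[+ _].
  by lra.
have [F2 F2E] : exists F : cumulative R R, F =1 (fun x => K * x - w x).
  apply: cumulative_of_continuous; last by move=> x; apply: cvgB; [exact: cK|exact: cw].
  move=> x y xy; rewrite -subr_ge0.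
  have := wK y x; rewrite (@ger0_norm _ (y - x)) ?subr_ge0// ler_norml => /andP[_ +].
  by lra.
pose m1 := lebesgue_stieltjes_measure F1.
pose m2 := lebesgue_stieltjes_measure F2.
have K2 : 0 <= (2 * K)^-1 by rewrite invr_ge0 mulr_ge0// ltW.
have nuE (A : set (measurableTypeR R)) : mscale (NngNum K2) (measure_add m1 m2) A =
    ((2 * K)^-1%:E * (m1 A + m2 A))%E.
  by rewrite -measure_addE.
have muE A : measurable A -> mu A = mscale (NngNum K2) (measure_add m1 m2) A.
  apply: lebesgue_measure_unique => X /ocitvP[->|[[x y] /= xy ->]].
    by rewrite !measure0.
  rewrite nuE /m1 /m2 !lebesgue_stieltjes_itv_oc ?ltW//.
  rewrite lebesgue_measure_itv/= lte_fin xy -EFinB -EFinD -EFinM !F1E !F2E.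
  by congr EFin; field; exact: lt0r_neq0.
have m12 A : measurable A -> (m1 A + m2 A = (2 * K)%:E * mu A)%E.
  move=> mA; rewrite muE// nuE muleA -EFinM divff ?mul1e//.
  by rewrite mulf_neq0// gt_eqF.
pose D : set (measurableTypeR R) := `]0, a]%classic.
have mD : measurable D by exact: measurable_itv.
have m1D : (m1 D < +oo)%E by rewrite /m1 lebesgue_stieltjes_itv_oc// ltry.
have m2D : (m2 D < +oo)%E by rewrite /m2 lebesgue_stieltjes_itv_oc// ltry.
pose n1 := mfrestr mD m1D.
pose n2 := mfrestr mD m2D.
have n1E E : E `<=` D -> n1 E = m1 E.
  by move=> ED; rewrite /n1 /mfrestr /mrestr setIidl.
have n2E E : E `<=` D -> n2 E = m2 E.
  by move=> ED; rewrite /n2 /mfrestr /mrestr setIidl.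
have d1 : n1 `<< mu.
  apply/null_content_dominatesP => A mA muA0; apply/eqP.
  rewrite eq_le measure_ge0 andbT.
  apply: (@le_trans _ _ (m1 A)); first by apply: le_measure; rewrite ?inE//; exact: measurableI.
  by have := m12 A mA; rewrite muA0 mule0 => <-; rewrite leeDl.
have d2 : n2 `<< mu.
  apply/null_content_dominatesP => A mA muA0; apply/eqP.
  rewrite eq_le measure_ge0 andbT.
  apply: (@le_trans _ _ (m2 A)); first by apply: le_measure; rewrite ?inE//; exact: measurableI.
  by have := m12 A mA; rewrite muA0 mule0 => <-; rewrite leeDr.
pose h1 := Radon_Nikodym_SigmaFinite.f n1 mu.
pose h2 := Radon_Nikodym_SigmaFinite.f n2 mu.
have i1 : mu.-integrable setT h1 := Radon_Nikodym_SigmaFinite.f_integrable d1.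
have i2 : mu.-integrable setT h2 := Radon_Nikodym_SigmaFinite.f_integrable d2.
have h12 : ae_eq mu D (fun x => h1 x + h2 x)%E (cst (2 * K)%:E).
  apply: integral_ae_eq => //.
    apply: integrableD => //.
      exact: (integrableS measurableT).
    exact: (integrableS measurableT).
  move=> E ED mE; rewrite integralD//; last 2 first.
    exact: (integrableS measurableT).
    exact: (integrableS measurableT).
  rewrite -(Radon_Nikodym_SigmaFinite.f_integral d1)// -(Radon_Nikodym_SigmaFinite.f_integral d2)//.
  rewrite integral_cst// -m12//.
  by congr (_ + _)%E; [exact: n1E|exact: n2E].
pose g x := fine (h1 x).
have gE x : (g x)%:E = h1 x.
  by rewrite /g fineK// Radon_Nikodym_SigmaFinite.f_fin_num.
have mg : measurable_fun setT g.
  apply/measurable_EFinP; rewrite (_ : _ \o _ = h1); first exact: measurable_int i1.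
  by apply/funext => x; exact: gE.
(* the density is at most [2 K] only almost everywhere on ]0, a] *)
pose h (x : R) := Num.min (g x) (2 * K) - K.
exists h; split.
- apply: measurable_funB => //; exact: measurable_minr.
- move=> x; have g0 : 0 <= g x.
    by rewrite -lee_fin gE Radon_Nikodym_SigmaFinite.f_ge0.
  rewrite ler_norml lerBlDr lerBrDr addNr le_min g0 mulr_ge0 ?(ltW K0)//=.
  by rewrite ge_min; apply/orP; right; lra.
move=> t /andP[t0 ta].
have mh : measurable_fun setT h.
  by apply: measurable_funB => //; exact: measurable_minr.
have tD : `]0, t]%classic `<=` D by apply: subset_itvl; rewrite bnd_simp.
have ig : mu.-integrable `]0, t] (EFin \o g).
  rewrite (_ : _ \o _ = h1); first exact: (integrableS measurableT).
  by apply/funext => x; exact: gE.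
have icst : mu.-integrable `]0, t] (EFin \o cst K).
  apply: measurable_bounded_integrable => //=.
    by rewrite lebesgue_measure_itv/=; case: ifP => // _; rewrite -EFinB ltry.
  by exists `|K|; split => // M KM x _ /=; exact: ltW.
have -> : \int[mu]_(s in `[0, t]) h s = \int[mu]_(s in `]0, t]) (g s - K).
  rewrite /Rintegral; congr fine.
  rewrite -integral_itv_obnd_cbnd; last first.
    by apply/measurable_EFinP; exact: (measurable_funS measurableT).
  apply: ae_eq_integral => //.
  - by apply/measurable_EFinP; exact: (measurable_funS measurableT).
  - apply/measurable_EFinP; apply: (measurable_funS measurableT) => //.
    exact: measurable_funB.
  apply: filterS h12 => x h12x /tD Dx; have := h12x Dx.
  have h2E : h2 x = (fine (h2 x))%:E.
    by rewrite fineK// Radon_Nikodym_SigmaFinite.f_fin_num.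
  rewrite -gE h2E -EFinD => -[h12E].
  have g20 : 0 <= fine (h2 x) by rewrite fine_ge0// Radon_Nikodym_SigmaFinite.f_ge0.
  by rewrite /h /= min_l// -h12E lerDl.
rewrite RintegralB// Rintegral_cst//.
have -> : \int[mu]_(s in `]0, t]) g s = F1 t - F1 0.
  rewrite /Rintegral -[RHS]/(fine (F1 t - F1 0)%:E); congr fine.
  rewrite -lebesgue_stieltjes_itv_oc//.
  transitivity (\int[mu]_(x in `]0%R, t]) h1 x)%E.
    by apply: eq_integral => x _; exact: gE.
  rewrite -(Radon_Nikodym_SigmaFinite.f_integral d1)//.
  exact: n1E.
rewrite /= lebesgue_measure_itv/= lte_fin !F1E mulr0 add0r.
case: ltP => [_|t0']; first by rewrite -EFinB/= subr0; ring.
have -> : t = 0 by apply/eqP; rewrite eq_le t0 t0'.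
by rewrite !mulr0; ring.
Qed.

End Lipschitz_density.

(** * Weak derivatives and primitives *)

Section Weak_derivative.
Context {R : realType}.
Notation mu := (@lebesgue_measure R).
Implicit Types (a s t x : R) (f g h u v w phi : R -> R).

(** Composition with [clamp a] turns continuity within [0, a] into continuity on
    the line, and keeps Lipschitz constants. *)
Definition clamp a t : R := Num.max 0 (Num.min t a).

Lemma clamp_itv a t : 0 <= a -> 0 <= clamp a t <= a.
Proof.
move=> a0; rewrite /clamp le_max lexx/= ge_max a0/= ge_min lexx orbT//.
Qed.

Lemma clamp_id a t : 0 <= t <= a -> clamp a t = t.
Proof. by move=> /andP[t0 ta]; rewrite /clamp min_l// max_r. Qed.

Lemma clamp_lipschitz a s t : `|clamp a s - clamp a t| <= `|s - t|.
Proof.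
wlog st : s t / s <= t => [H|].
  by have [/H//|/ltW/H] := leP s t; rewrite distrC [in leRHS]distrC.
suff /andP[H1 H2] : 0 <= clamp a t - clamp a s <= t - s.
  by rewrite distrC ger0_norm// distrC ger0_norm ?subr_ge0.
rewrite /clamp; case: (leP s a) => sa; case: (leP t a) => ta;
  case: (leP 0 s) => s0; case: (leP 0 t) => t0; case: (leP 0 a) => a0; lra.
Qed.

Lemma continuous_clamp a : continuous (clamp a).
Proof.
apply: (lipschitz_continuous 1) => x y; rewrite mul1r; exact: clamp_lipschitz.
Qed.

Lemma continuous_comp_clamp a v : 0 <= a -> {within `[0, a], continuous v} ->
  continuous (v \o clamp a).
Proof.
move=> a0 /subspace_continuousP cv x.
have xA : `[0, a]%classic (clamp a x) by rewrite /= in_itv/=; exact: clamp_itv.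
have cx := continuous_clamp a x.
apply: (@cvg_comp _ _ _ (clamp a) v _ (within `[0, a] (nbhs (clamp a x))));
  last exact: cv.
move=> P /= /cx Px.
have {}Px : \forall y \near x, `[0, a]%classic (clamp a y) -> P (clamp a y) by [].
suff : \forall y \near x, P (clamp a y) by [].
apply: filterS Px => y; apply.
by rewrite /= in_itv/=; exact: clamp_itv.
Qed.

Lemma bounded_measurable_continuous_itv a v : 0 <= a ->
  {within `[0, a], continuous v} -> bounded_measurable (v \_ `[0, a]).
Proof.
move=> a0 cv; have cva := continuous_comp_clamp a v a0 cv.
have [c _ vc] := EVT_max a0 cv.
have [d _ vd] := EVT_min a0 cv.
have E : v \_ `[0, a] = (v \o clamp a) \_ `[0, a].
  by apply/funext => x; rewrite !restrict_itvE; case: ifP => // xa; rewrite /= clamp_id.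
rewrite E; apply: (bounded_measurable_restrict _ _ (`|v c| + `|v d|)) => //.
  exact: continuous_measurable_fun.
move=> x xa; have xa' : x \in `[0, a] by [].
move: (xa'); rewrite in_itv/= => /clamp_id ->.
have := vc _ xa'; have := vd _ xa'.
have := ler_norm (v c); have := ler_norm (- v d); rewrite normrN.
have := normr_ge0 (v c); have := normr_ge0 (v d).
by rewrite ler_norml; lra.
Qed.

(** On a bounded interval [|g| <= 1 + g^2]. *)
Lemma in_L2_L1 a g : in_L2 a g -> L1 (g \_ `]0, a[).
Proof.
move=> gL2; pose G := g \_ `]0, a[.
have mG : measurable_fun setT G.
  by have := gL2; rewrite /in_L2 inE => /andP[]; rewrite inE.
have IG := Lfun2_integrable_sqr gL2.
apply: (L1_dominated _ (fun x => ((cst (1 : R)) \_ `]0, a[) x + G x ^+ 2)) => //.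
- move=> x; rewrite -/G /G !patchE; case: ifPn => _; last by rewrite normr0 addr_ge0 ?sqr_ge0.
  rewrite -real_normK ?num_real// /cst.
  have := sqr_ge0 (`|g x| - 2^-1); lra.
- apply: L1D; last exact: IG.
  apply/L1_restrict => //; apply: measurable_bounded_integrable => //=.
    by rewrite lebesgue_measure_itv/=; case: ifP => // _; rewrite -EFinB ltry.
  by exists 1; split => // M KM x _ /=; rewrite normr1 ltW.
Qed.

Lemma bounded_in_L2 a C v : measurable_fun `]0, a[ v ->
  (forall x, 0 < x < a -> `|v x| <= C) -> in_L2 a v.
Proof.
move=> mv vC; rewrite /in_L2 inE; apply/andP; split.
  by rewrite inE/=; apply/(measurable_restrictT _ (measurable_itv _)).
rewrite inE/= /finite_norm unlock/=.
apply: poweR_lty.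
apply: (@le_lt_trans _ _ (\int[mu]_x (((cst (C ^+ 2)) \_ `]0, a[) x)%:E)%E).
  apply: ge0_le_integral => //.
  - apply/measurable_EFinP; apply: (measurableT_comp (measurable_powR 2)).
    apply: measurableT_comp => //.
    by apply/(measurable_restrictT _ (measurable_itv _)).
  - apply/measurable_EFinP.
    by apply/(measurable_restrictT _ (measurable_itv _)).
  - move=> x _; rewrite /= lee_fin !patchE; case: ifPn => [|_].
      rewrite inE/= in_itv/= => xa; rewrite powR_mulrn//.
      by rewrite lerXn2r ?nnegrE// ?vC// (le_trans (normr_ge0 (v x)))// vC.
    by rewrite normr0 powR0.
have : L1 ((cst (C ^+ 2)) \_ `]0, a[).
  apply/L1_restrict => //; apply: measurable_bounded_integrable => //=.
    by rewrite lebesgue_measure_itv/=; case: ifP => // _; rewrite -EFinB ltry.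
  by exists `|C ^+ 2|; split => // M KM x _ /=; rewrite ltW.
exact: (integrable_lty measurableT).
Qed.

Lemma Rintegral_derive1 phi s t : (forall x, derivable phi x 1) ->
  continuous (derive1 phi) -> s <= t ->
  \int[mu]_(x in `[s, t]) derive1 phi x = phi t - phi s.
Proof.
move=> dphi cphi; rewrite le_eqVlt => /predU1P[->|st].
  by rewrite set_itv1 Rintegral_set1 subrr.
have cp x : {for x, continuous phi}.
  by apply: differentiable_continuous; apply/derivable1_diffP; exact: dphi.
rewrite /Rintegral (@continuous_FTC2 _ _ phi)//.
- exact: continuous_subspaceT.
- split=> [x _|//|]; first exact: dphi.
  + by apply: cvg_at_right_filter; exact: cp.
  + by apply: cvg_at_left_filter; exact: cp.
Qed.

Lemma test_function_outside a phi : test_function a phi ->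
  forall x, ~~ (0 < x < a) -> phi x = 0 /\ derive1 phi x = 0.
Proof.
move=> [dphi cphi [K [cK KJ phiK]]] x xJ.
have xK : ~ K x by move=> /KJ /=; rewrite in_itv/=; exact/negP.
split; first exact: phiK.
have oK : open (~` K) by apply: closed_openC; exact: compact_closed.
rewrite derive1E -(derive_cst (0 : R) x 1).
apply: near_eq_derive => //.
have : nbhs x (~` K) by exact: open_nbhs_nbhs.
by apply: filterS => y /phiK.
Qed.

Lemma continuous_support_L1 a v : 0 <= a -> continuous v ->
  (forall x, ~~ (0 <= x <= a) -> v x = 0) -> bounded_measurable v /\ L1 v.
Proof.
move=> a0 cv v0.
have E : v = v \_ `[0, a].
  by apply/funext => x; rewrite restrict_itvE; case: ifPn => // /v0.
have bm : bounded_measurable v.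
  by rewrite E; apply: bounded_measurable_continuous_itv => //; exact: continuous_subspaceT.
split=> //; have [mv [C vC]] := bm.
by apply: (L1_bounded_support C _ 0 a) => // x; rewrite in_itv/=; exact: v0.
Qed.

Lemma test_function_continuous a phi : test_function a phi -> continuous phi.
Proof.
move=> [dphi _ _] x; apply: differentiable_continuous; apply/derivable1_diffP.
exact: dphi.
Qed.

Lemma test_function_L1 a phi : 0 <= a -> test_function a phi ->
  [/\ bounded_measurable phi, bounded_measurable (derive1 phi) &
      L1 (derive1 phi)].
Proof.
move=> a0 tphi; have [_ cphi _] := tphi.
have H x : ~~ (0 <= x <= a) -> phi x = 0 /\ derive1 phi x = 0.
  move=> xa; apply: (test_function_outside a) => //.
  by apply: contra xa => /andP[/ltW -> /ltW ->].
have [|bphi _] := continuous_support_L1 a phi a0 (test_function_continuous a phi tphi).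
  by move=> x /H[].
by have [|bd Ld] := continuous_support_L1 a (derive1 phi) a0 cphi; first by move=> x /H[].
Qed.

Lemma Rintegral_test_function a phi v : test_function a phi ->
  \int[mu]_(x in `]0, a[) (v x * derive1 phi x) = \int[mu]_x (v x * derive1 phi x)
  /\ \int[mu]_(x in `]0, a[) (v x * phi x) = \int[mu]_x (v x * phi x).
Proof.
move=> tphi.
have H x : x \notin `]0, a[%classic -> phi x = 0 /\ derive1 phi x = 0.
  by rewrite notin_setE/= in_itv/= => /negP; exact: test_function_outside.
split; rewrite [LHS]Rintegral_mkcond; apply: eq_Rintegral => x _;
  rewrite patchE; case: ifPn => // /H [p0 d0].
  by rewrite d0 mulr0.
by rewrite p0 mulr0.
Qed.

Definition primitive h t : R := \int[mu]_(s in `[0, t]) h s.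

Lemma primitiveE h t : primitive h t = \int[mu]_s ((0 <= s <= t)%R%:R * h s).
Proof.
rewrite /primitive Rintegral_mkcond; apply: eq_Rintegral => s _.
rewrite patchE; case: ifPn => [|].
  by rewrite inE/= in_itv/= => ->; rewrite mul1r.
by rewrite notin_setE/= in_itv/= => /negP/negbTE ->; rewrite mul0r.
Qed.

Lemma measurable_interval_indicator :
  measurable_fun setT (fun z : R * R => (0 <= z.2 <= z.1)%R%:R : R).
Proof.
have -> : (fun z : R * R => (0 <= z.2 <= z.1)%R%:R : R) =
    (fun z => if (0 <= z.2) && (z.2 <= z.1) then 1 else 0).
  by apply/funext => z; case: ifP.
apply: measurable_fun_ifT => //.
apply: measurable_and.
  by apply: measurable_fun_ler => //; exact: measurable_snd.
by apply: measurable_fun_ler; [exact: measurable_snd|exact: measurable_fst].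
Qed.

(** Integration by parts against a test function, which is Fubini's theorem
    on the triangle [0 <= s <= x]. *)
Lemma primitive_by_parts a h phi : 0 <= a -> L1 h -> test_function a phi ->
  L1 (fun x => derive1 phi x * primitive h x) /\
  \int[mu]_x (derive1 phi x * primitive h x) = - \int[mu]_x (h x * phi x).
Proof.
move=> a0 Lh tphi; have [dphi cphi _] := tphi.
have [bphi _ Lphi] := test_function_L1 a phi a0 tphi.
have mb (z : R * R) : `|(0 <= z.2 <= z.1)%R%:R| <= 1 :> R.
  by case: (_ && _); rewrite ?normr1 ?normr0.
have E x : primitive h x = \int[mu]_s ((0 <= (x, s).2 <= (x, s).1)%R%:R * h s).
  exact: primitiveE.
have Lker := L1_kernel 1 _ _ _ Lphi Lh measurable_interval_indicator mb.
have Fub := Rintegral_Fubini 1 _ _ _ Lphi Lh measurable_interval_indicator mb.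
split.
  by move: Lker; rewrite (_ : (fun x => _) = (fun x => derive1 phi x * primitive h x))//;
    apply/funext => x; rewrite E.
transitivity (\int[mu]_x (derive1 phi x *
    \int[mu]_y ((0 <= (x, y).2 <= (x, y).1)%R%:R * h y))).
  by apply: eq_Rintegral => x _; rewrite E.
have Lhphi : L1 (fun x => h x * phi x).
  by have [mphi [C phiC]] := bphi; exact: (L1M_bounded C).
rewrite Fub -[RHS]mulN1r -RintegralZl//; apply: eq_Rintegral => y _.
rewrite mulN1r -mulrN; congr (_ * _) => /=.
have [y0|y0] := leP 0 y; last first.
  have [-> _] : phi y = 0 /\ derive1 phi y = 0.
    by apply: (test_function_outside a) => //; rewrite ltNge (ltW y0).
  rewrite oppr0; under eq_Rintegral do rewrite mulr0.
  by rewrite Rintegral_cst// mul0r.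
pose b := Num.max y a.
have [phib _] : phi b = 0 /\ derive1 phi b = 0.
  apply: (test_function_outside a) => //.
  by rewrite negb_and -!leNgt [X in _ || X]le_max lexx !orbT.
rewrite -[RHS]add0r -phib -Rintegral_derive1//; last by rewrite le_max lexx.
rewrite [RHS]Rintegral_mkcond; apply: eq_Rintegral => x _; rewrite patchE.
case: ifPn => [|]; first by rewrite inE/= in_itv/= => /andP[-> _]; rewrite mulr1.
rewrite notin_setE/= in_itv/= => /negP; rewrite negb_and.
case: (leP y x) => yx /= xb; last by rewrite mulr0.
have [_ ->] : phi x = 0 /\ derive1 phi x = 0; last by rewrite mul0r.
apply: (test_function_outside a) => //; rewrite negb_and -!leNgt.
move: xb; rewrite -ltNge => /ltW xb.
by rewrite (le_trans _ xb) ?orbT// le_max lexx orbT.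
Qed.

Lemma derive1_improper_primitive v x : continuous v -> L1 v ->
  let V y := \int[mu]_(t in `]-oo, y]) v t in
  derivable V x 1 /\ derive1 V x = v x.
Proof.
move=> cv Lv V; apply: (@continuous_FTC1 _ v -oo%O x (x + 1)) => //.
- by rewrite ltrDl.
- exact: (integrableS measurableT).
- by rewrite ltNyr.
- exact: cv.
Qed.

Lemma continuous_Rintegral_eq0 v : continuous v -> (forall x, 0 <= v x) ->
  L1 v -> \int[mu]_x v x = 0 -> forall x, v x = 0.
Proof.
move=> cv v0 Lv v00 x.
have [_ <-] := derive1_improper_primitive v x cv Lv.
rewrite (_ : (fun y => _) = cst 0); first exact: derive1_cst.
apply/funext => y; apply/eqP; rewrite eq_le Rintegral_ge0 ?andbT//.
rewrite -[leRHS]v00 Rintegral_mkcond; apply: le_Rintegral => //.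
  apply/(L1_restrict _ _ (measurable_itv _)); exact: (integrableS measurableT).
by move=> t _; rewrite patchE; case: ifP.
Qed.

(** A continuous function orthogonal to the derivatives of all test functions
    is constant: test with a [phi] whose derivative is [eta (v - c)], where
    [eta >= 0] is a cut-off and [c] the [eta]-mean of [v]; then the integral
    of [eta (v - c)^2] vanishes. *)
Lemma du_Bois_Reymond_interior a e v : 0 < e -> e < a - e -> continuous v ->
  (forall phi, test_function a phi -> \int[mu]_x (v x * derive1 phi x) = 0) ->
  exists c, forall x, e < x < a - e -> v x = c.
Proof.
move=> e0 ea cv vphi.
have a0 : 0 <= a by lra.
pose eta x : R := Num.max 0 ((x - e) * (a - e - x)).
have eta0 x : 0 <= eta x by rewrite /eta le_max lexx.
have etaN x : ~~ (e <= x <= a - e) -> eta x = 0.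
  rewrite negb_and -!ltNge => /orP[xe|xe]; rewrite /eta max_l//.
    by rewrite nmulr_rle0 ?subr_lt0// subr_ge0 ltW// (lt_trans xe).
  by rewrite pmulr_rle0 ?subr_gt0 ?subr_le0 ?(lt_trans _ xe)// ltW.
have etaP x : e < x < a - e -> 0 < eta x.
  by move=> /andP[ex xe]; rewrite /eta lt_max mulr_gt0 ?orbT// subr_gt0.
have ceta : continuous eta.
  move=> x; apply: (@continuous_max _ _ (cst 0) (fun x => (x - e) * (a - e - x))).
    exact: cvg_cst.
  apply: cvgM; apply: cvgB => //; exact: cvg_cst.
have wide u x : (forall x, ~~ (e <= x <= a - e) -> u x = 0) ->
    ~~ (0 <= x <= a) -> u x = 0 :> R.
  move=> uN xa; apply: uN; apply: contra xa => /andP[ex xe]; apply/andP; split; lra.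
have [_ Leta] := continuous_support_L1 a eta a0 ceta (fun x => wide eta x etaN).
have cev : continuous (fun x => eta x * v x) by move=> x; apply: cvgM; [exact: ceta|exact: cv].
have [|_ Lev] := continuous_support_L1 a _ a0 cev.
  by move=> x xa; rewrite (wide _ _ etaN)// mul0r.
have Ieta : \int[mu]_x eta x != 0.
  apply/eqP => /(continuous_Rintegral_eq0 eta ceta eta0 Leta) /(_ (a / 2)) H.
  have ha : e < a / 2 < a - e by apply/andP; split; lra.
  by have := etaP _ ha; rewrite H ltxx.
pose c := (\int[mu]_x (eta x * v x)) / \int[mu]_x eta x.
exists c.
pose psi x := eta x * (v x - c).
have cpsi : continuous psi.
  by move=> x; apply: cvgM; [exact: ceta|apply: cvgB; [exact: cv|exact: cvg_cst]].
have psiN x : ~~ (e <= x <= a - e) -> psi x = 0.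
  by move=> /etaN; rewrite /psi => ->; rewrite mul0r.
have [bpsi Lpsi] := continuous_support_L1 a psi a0 cpsi (fun x => wide psi x psiN).
have Ipsi : \int[mu]_x psi x = 0.
  transitivity (\int[mu]_x (eta x * v x - c * eta x)).
    by apply: eq_Rintegral => x _; rewrite /psi; ring.
  rewrite RintegralB//; last exact: L1Z.
  by rewrite RintegralZl// /c divfK// subrr.
pose phi x := \int[mu]_(t in `]-oo, x]) psi t.
have dphi x := derive1_improper_primitive psi x cpsi Lpsi.
have dphiE : derive1 phi = psi by apply/funext => x; have [] := dphi x.
have tphi : test_function a phi.
  split.
  - by move=> x; have [] := dphi x.
  - by rewrite dphiE.
  - exists `[e, a - e]%classic; split.
    + exact: segment_compact.
    + by move=> x /=; rewrite !in_itv/= => /andP[ex xe]; apply/andP; split; lra.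
    + move=> x /=; rewrite in_itv/= => /negP; rewrite negb_and -!ltNge.
      rewrite /phi Rintegral_mkcond => /orP[xe|xe].
        rewrite -[RHS](mul0r (fine (mu setT))) -Rintegral_cst//.
        apply: eq_Rintegral => t _; rewrite patchE; case: ifPn => //.
        rewrite inE/= in_itv/= => tx; apply: psiN.
        by rewrite negb_and -!ltNge (le_lt_trans tx xe).
      rewrite -[RHS]Ipsi; apply: eq_Rintegral => t _; rewrite patchE.
      case: ifPn => //; rewrite notin_setE/= in_itv/= => /negP; rewrite -ltNge => xt.
      by rewrite psiN// negb_and -!ltNge (lt_trans xe xt) orbT.
pose q x := psi x * (v x - c).
have cq : continuous q.
  by move=> x; apply: cvgM; [exact: cpsi|apply: cvgB; [exact: cv|exact: cvg_cst]].
have q0 x : 0 <= q x by rewrite /q /psi -mulrA mulr_ge0// -expr2 sqr_ge0.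
have cvpsi : continuous (fun x => v x * psi x).
  by move=> x; apply: cvgM; [exact: cv|exact: cpsi].
have [|_ Lvpsi] := continuous_support_L1 a _ a0 cvpsi.
  by move=> x xa; rewrite (wide _ _ psiN)// mulr0.
have [|_ Lq] := continuous_support_L1 a q a0 cq.
  by move=> x xa; rewrite /q (wide _ _ psiN)// mul0r.
have Iq : \int[mu]_x q x = 0.
  transitivity (\int[mu]_x (v x * psi x - c * psi x)).
    by apply: eq_Rintegral => x _; rewrite /q; ring.
  rewrite RintegralB//; last exact: L1Z.
  by rewrite RintegralZl// Ipsi mulr0 subr0 -[RHS](vphi _ tphi) dphiE.
move=> x xe; have := continuous_Rintegral_eq0 q cq q0 Lq Iq x.
rewrite /q /psi -mulrA => /eqP; rewrite mulf_eq0 gt_eqF ?etaP//=.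
by rewrite mulf_eq0 orbb subr_eq0 => /eqP.
Qed.

(** Every point of ]0, a[ shares a compact subinterval with the midpoint; the
    endpoints follow by continuity. *)
Lemma du_Bois_Reymond a v : 0 < a -> continuous v ->
  (forall phi, test_function a phi -> \int[mu]_x (v x * derive1 phi x) = 0) ->
  forall t, 0 <= t <= a -> v t = v 0.
Proof.
move=> a0 cv vphi.
have H s : 0 < s < a -> v s = v (a / 2).
  move=> /andP[s0 sa].
  pose e := Num.min (Num.min s (a - s)) (a / 2) / 2.
  have e1 : 0 < Num.min (Num.min s (a - s)) (a / 2).
    by rewrite !lt_min s0 subr_gt0 sa/= divr_gt0.
  have e2 : Num.min (Num.min s (a - s)) (a / 2) <= s.
    by rewrite !ge_min lexx.
  have e3 : Num.min (Num.min s (a - s)) (a / 2) <= a - s.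
    by rewrite !ge_min lexx !orbT.
  have e4 : Num.min (Num.min s (a - s)) (a / 2) <= a / 2.
    by rewrite !ge_min lexx !orbT.
  have [||c Hc] := du_Bois_Reymond_interior a e v _ _ cv vphi.
  - by rewrite /e; lra.
  - by rewrite /e; lra.
  - by rewrite !Hc// /e; apply/andP; split; lra.
have Hc s : 0 <= s <= a -> v s = v (a / 2).
  move=> /andP[s0 sa]; apply/eqP; rewrite -subr_eq0 -normr_le0.
  apply/ler_addgt0Pr => e e0; rewrite add0r.
  have /cvgrPdist_le/(_ e e0)/nbhs_ballP[d /= d0 Hd] := cv s.
  pose th := Num.min 1 (d / (2 * a)).
  have th0 : 0 < th by rewrite lt_min ltr01 divr_gt0// mulr_gt0.
  have th1 : th <= 1 by rewrite ge_min lexx.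
  have tha : th * a <= d / 2.
    apply: (@le_trans _ _ (d / (2 * a) * a)).
      by rewrite ler_wpM2r ?(ltW a0)// ge_min lexx orbT.
    by rewrite le_eqVlt; apply/orP; left; apply/eqP; field; exact: lt0r_neq0.
  (* a point of the open interval, on the way from [s] to the midpoint *)
  pose y := s + (a / 2 - s) * th.
  have ath : 0 < a * th by rewrite mulr_gt0.
  have s1 : 0 <= s * (1 - th) by rewrite mulr_ge0// subr_ge0.
  have s2 : 0 <= (a - s) * (1 - th) by rewrite mulr_ge0// subr_ge0.
  rewrite -(H y); last by rewrite /y; apply/andP; split; lra.
  apply: Hd; rewrite /ball/= /y opprD addNKr normrN normrM (gtr0_norm th0).
  apply: (@le_lt_trans _ _ (a * th)); last by rewrite mulrC; lra.
  by rewrite ler_wpM2r ?(ltW th0)// ler_norml; apply/andP; split; lra.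
by move=> t ta; rewrite Hc// [RHS]Hc// lexx ltW.
Qed.

(** [w] and the primitive of [g] have the same weak derivative, so their
    difference is constant by [du_Bois_Reymond]. *)
Lemma weak_derivative_primitive a w g : 0 < a -> {within `[0, a], continuous w} ->
  is_weak_derivative a w g ->
  L1 (g \_ `]0, a[) /\
  forall t, 0 <= t <= a -> w t = w 0 + primitive (g \_ `]0, a[) t.
Proof.
move=> a0 cw [gL2 wg]; have Lg := in_L2_L1 a g gL2.
have a0' := ltW a0.
split=> // t ta; pose G := primitive (g \_ `]0, a[).
have cG : {within `[0, a], continuous G}.
  by apply: parameterized_integral_continuous => //; exact: (integrableS measurableT).
have cv : continuous ((fun x => w x - G x) \o clamp a).
  apply: continuous_comp_clamp => // x; apply: cvgB; [exact: cw|exact: cG].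
have vphi phi : test_function a phi ->
    \int[mu]_x (((fun x => w x - G x) \o clamp a) x * derive1 phi x) = 0.
  move=> tphi; have [bphi bdphi Lphi] := test_function_L1 a phi a0' tphi.
  have [LG IG] := primitive_by_parts a _ phi a0' Lg tphi.
  have [mw [C wC]] := bounded_measurable_continuous_itv a w a0' cw.
  have Lw : L1 (fun x => derive1 phi x * (w \_ `[0, a]) x) by exact: (L1M_bounded C).
  transitivity (\int[mu]_x (derive1 phi x * (w \_ `[0, a]) x - derive1 phi x * G x)).
    apply: eq_Rintegral => x _ /=.
    have [xa|/(test_function_outside a phi tphi)[_ ->]] := boolP (0 < x < a); last first.
      by rewrite mulr0 !mul0r subrr.
    have xa' : 0 <= x <= a by case/andP: xa => /ltW -> /ltW ->.
    by rewrite clamp_id// restrict_itvE xa'; ring.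
  rewrite RintegralB// IG opprK.
  have [E1 _] := Rintegral_test_function a phi w tphi.
  have [_ E2] := Rintegral_test_function a phi (g \_ `]0, a[) tphi.
  have -> : \int[mu]_x (derive1 phi x * (w \_ `[0, a]) x) =
      \int[mu]_(x in `]0, a[) (w x * derive1 phi x).
    rewrite E1; apply: eq_Rintegral => x _.
    have [xa|/(test_function_outside a phi tphi)[_ ->]] := boolP (0 < x < a); last first.
      by rewrite mulr0 !mul0r.
    have xa' : 0 <= x <= a by case/andP: xa => /ltW -> /ltW ->.
    by rewrite restrict_itvE xa' mulrC.
  rewrite wg// -E2 addrC; apply/eqP; rewrite subr_eq0; apply/eqP.
  by apply: eq_Rintegral => x xa; rewrite patchE xa.
have G0 : G 0 = 0 by rewrite /G /primitive set_itv1 Rintegral_set1.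
have := du_Bois_Reymond a _ a0 cv vphi t ta.
rewrite /= !clamp_id ?lexx// G0 subr0 => <-.
by rewrite /G subrK.
Qed.

Lemma primitive_weak_derivative a w h C : 0 < a -> measurable_fun setT h ->
  (forall x, `|h x| <= C) -> {within `[0, a], continuous w} ->
  (forall t, 0 <= t <= a -> w t = w 0 + primitive h t) ->
  is_weak_derivative a w h.
Proof.
move=> a0 mh hC cw wE; have a0' := ltW a0; split.
  by apply: (bounded_in_L2 a C) => //; exact: (measurable_funS measurableT).
move=> phi tphi; have [bphi bdphi Lphi] := test_function_L1 a phi a0' tphi.
pose ha := h \_ `[0, a].
have Lh : L1 ha.
  apply/(L1_restrict _ _ (measurable_itv _)).
  apply: measurable_bounded_integrable => //=.
  - by rewrite lebesgue_measure_itv/=; case: ifP => // _; rewrite -EFinB ltry.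
  - exact: (measurable_funS measurableT).
  - by exists C; split => // [|M CM x _ /=]; [exact: num_real|rewrite (le_trans (hC x))// ltW].
have [LG IG] := primitive_by_parts a _ phi a0' Lh tphi.
have [E1 _] := Rintegral_test_function a phi w tphi.
have [_ E2] := Rintegral_test_function a phi h tphi.
rewrite E1 E2.
transitivity (\int[mu]_x (w 0 * derive1 phi x + derive1 phi x * primitive ha x)).
  apply: eq_Rintegral => x _.
  have [xa|/(test_function_outside a phi tphi)[_ ->]] := boolP (0 < x < a); last first.
    by rewrite !mulr0 mul0r addr0.
  have xa' : 0 <= x <= a by case/andP: xa => /ltW -> /ltW ->.
  rewrite wE// mulrDl [X in _ + X]mulrC; congr (_ + _ * _).
  apply: eq_Rintegral => s; rewrite inE/= in_itv/= => /andP[s0 sx].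
  by rewrite /ha restrict_itvE s0 (le_trans sx)//; case/andP: xa'.
rewrite RintegralD//; last exact: L1Z.
rewrite RintegralZl// IG.
have -> : \int[mu]_x derive1 phi x = 0.
  have := test_function_outside a phi tphi; have [dphi cphi _] := tphi => H.
  transitivity (\int[mu]_(x in `[0, a]) derive1 phi x).
    rewrite [RHS]Rintegral_mkcond; apply: eq_Rintegral => x _.
    rewrite restrict_itvE; case: ifPn => // xa; have [|//] := H x.
    by apply: contra xa => /andP[/ltW -> /ltW ->].
  rewrite Rintegral_derive1//.
  have [-> _] : phi a = 0 /\ derive1 phi a = 0 by apply: H; rewrite ltxx andbF.
  have [-> _] : phi 0 = 0 /\ derive1 phi 0 = 0 by apply: H; rewrite ltxx.
  by rewrite subrr.
rewrite mulr0 add0r; congr (- _); apply: eq_Rintegral => x _.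
have [xa|/(test_function_outside a phi tphi)[-> _]] := boolP (0 < x < a); last by rewrite !mulr0.
have xa' : 0 <= x <= a by case/andP: xa => /ltW -> /ltW ->.
by rewrite /ha restrict_itvE xa'.
Qed.

End Weak_derivative.

(** * The ABC derivative and its Volterra equation *)

Section Memory.
Context {R : realType}.
Notation mu := (@lebesgue_measure R).
Implicit Types (al a s t m : R) (g w F : R -> R).

(** The convolution with the kernel [E_al(m t^al)] that defines the ABC
    derivative, for [m = - al / (1 - al)].  It is cut off to [0, a], as the
    fractional integral is applied to functions that vanish at negative
    times. *)
Definition memory al a m g t : R :=
  (0 <= t <= a)%R%:R * \int[mu]_s (ml_fun al a m (t - s) * g s).

Lemma measurable_shift_diff (v : R -> R) t : measurable_fun setT v ->
  measurable_fun setT (fun z : R * R => v (t - z.1 - z.2)).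
Proof.
move=> mv; apply: (measurableT_comp mv).
apply: measurable_funB; last exact: measurable_snd.
by apply: measurable_funB => //; exact: measurable_fst.
Qed.

Lemma measurable_diff (v : R -> R) : measurable_fun setT v ->
  measurable_fun setT (fun z : R * R => v (z.1 - z.2)).
Proof.
move=> mv; apply: (measurableT_comp mv).
by apply: measurable_funB; [exact: measurable_fst|exact: measurable_snd].
Qed.

Lemma L1_ml_fun_conv al a m g t : 0 < al -> L1 g ->
  L1 (fun s => g s * ml_fun al a m (t - s)).
Proof.
move=> al0 Lg; have [mk [C kC]] := bounded_measurable_ml_fun al a m al0.
apply: (L1M_bounded C) => //.
by apply: (measurableT_comp mk); exact: measurable_funB.
Qed.

Lemma bounded_measurable_memory al a m g : 0 < al -> L1 g ->
  bounded_measurable (memory al a m g).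
Proof.
move=> al0 Lg; have [mk [C kC]] := bounded_measurable_ml_fun al a m al0.
have LJ : L1 (fun t => (0 <= t <= a)%R%:R : R).
  rewrite (_ : (fun t => _) = (cst (1 : R)) \_ `[0, a]); last first.
    by apply/funext => t; rewrite restrict_itvE; case: ifP.
  apply/(L1_restrict _ _ (measurable_itv _)).
  apply: measurable_bounded_integrable => //=.
    by rewrite lebesgue_measure_itv/=; case: ifP => // _; rewrite -EFinB ltry.
  by exists 1; split => // M KM x _ /=; rewrite normr1 ltW.
split.
  apply: L1_measurable.
  exact: (L1_kernel C _ _ _ LJ Lg (measurable_diff _ mk) (fun z => kC _)).
exists (C * \int[mu]_s `|g s|) => t.
have Lkg : L1 (fun s => ml_fun al a m (t - s) * g s).
  by under eq_fun do rewrite mulrC; exact: L1_ml_fun_conv.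
have H : `|\int[mu]_s (ml_fun al a m (t - s) * g s)| <= C * \int[mu]_s `|g s|.
  apply: (le_trans (le_normr_Rintegral _ Lkg)) => //.
  rewrite -RintegralZl//; last exact: L1_norm.
  apply: le_Rintegral => //; first exact: L1_norm.
    by apply: L1Z; exact: L1_norm.
  by move=> s _; rewrite normrM ler_wpM2r.
rewrite /memory normrM (le_trans _ H)// ler_piMl//.
by case: (_ && _); rewrite ?normr1 ?normr0.
Qed.

(** Convolving the equation of the kernel with [g]: since convolution is
    associative, the memory term solves the same linear fractional equation,
    with the primitive of [g] as forcing term. *)
Lemma memory_equation al a m g t : 0 < al -> m != 0 -> L1 g ->
  (forall s, ~~ (0 <= s <= a) -> g s = 0) -> 0 <= t <= a ->
  memory al a m g t = primitive g t + m * frac_int al a (memory al a m g) t.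
Proof.
move=> al0 m0 Lg gN /andP[t0 ta].
have [mk [C kC]] := bounded_measurable_ml_fun al a m al0.
have Lp := L1_rl_kernel al a al0.
have -> : frac_int al a (memory al a m g) t =
    \int[mu]_r (rl_kernel al a r * \int[mu]_s (ml_fun al a m (t - (r, s).1 - (r, s).2) * g s)).
  apply: eq_Rintegral => r _ /=; rewrite /memory.
  have [r0|r0] := leP 0 r; last by rewrite rl_kernel_neg// !mul0r.
  have -> : (t - r <= a) by rewrite lerBlDr (le_trans ta)// lerDl.
  have [tr|tr] := leP 0 (t - r); first by rewrite mul1r.
  rewrite mul0r; congr (_ * _).
  rewrite -[LHS](mul0r (fine (mu setT))) -Rintegral_cst//.
  apply: eq_Rintegral => s _; have [s0|s0] := leP 0 s.
    by rewrite /ml_fun restrict_itvE (lt_geF (_ : t - r - s < 0)) ?mul0r//; lra.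
  by rewrite gN ?mulr0// (lt_geF s0).
rewrite (Rintegral_Fubini C _ _ _ Lp Lg (measurable_shift_diff _ t mk) (fun z => kC _)).
have -> : \int[mu]_y (g y * \int[mu]_x (rl_kernel al a x * ml_fun al a m (t - (x, y).1 - (x, y).2)))
   = \int[mu]_y (m^-1 * (g y * ml_fun al a m (t - y) - (0 <= y <= t)%R%:R * g y)).
  apply: eq_Rintegral => y _.
  have -> : \int[mu]_x (rl_kernel al a x * ml_fun al a m (t - (x, y).1 - (x, y).2)) =
      frac_int al a (ml_fun al a m) (t - y).
    by apply: eq_Rintegral => x _ /=; rewrite addrAC.
  have [y0|y0] := leP 0 y; last by rewrite gN ?(lt_geF y0)//; ring.
  have tya : t - y <= a by rewrite lerBlDr (le_trans ta)// lerDl.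
  apply: (mulfI m0); rewrite mulVKf// mulrCA frac_int_ml_fun//.
  by rewrite tya subr_ge0 andbT/= mulrBr [X in _ - X]mulrC.
have LJ : L1 (fun y => (0 <= y <= t)%R%:R * g y).
  rewrite (_ : (fun y => _) = g \_ `[0, t]); last first.
    by apply/funext => y; rewrite restrict_itvE; case: ifP; rewrite ?mul1r ?mul0r.
  by apply/(L1_restrict _ _ (measurable_itv _)); exact: (integrableS measurableT).
have Lkg := L1_ml_fun_conv al a m g t al0 Lg.
rewrite RintegralZl//; last exact: L1B.
rewrite RintegralB// mulVKf// -primitiveE addrC subrK /memory t0 ta mul1r.
by apply: eq_Rintegral => s _; rewrite mulrC.
Qed.

Lemma Rintegral_itv_oo_cc (k : R -> R) s t : mu.-integrable `]s, t[ (EFin \o k) ->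
  \int[mu]_(x in `[s, t]) k x = \int[mu]_(x in `]s, t[) k x.
Proof.
move=> /(measurable_int mu) mk; rewrite /Rintegral; congr fine.
rewrite -integral_itv_obnd_cbnd; last exact/emeasurable_fun_itv_bndo_bndcP.
by rewrite -integral_itv_bndo_bndc.
Qed.

Lemma ABC_memory al B a w t : 0 < al -> 0 < a -> 0 <= t <= a ->
  L1 (weak_derivative a w \_ `]0, a[) ->
  ABC al B a w t = B al / (1 - al) *
    memory al a (- (al / (1 - al))) (weak_derivative a w \_ `]0, a[) t.
Proof.
move=> al0 a0 /andP[t0 ta] Lg; rewrite /ABC; congr (_ * _).
set g := weak_derivative a w \_ _ in Lg *; set m := - _.
rewrite /memory t0 ta mul1r.
have Lkg := L1_ml_fun_conv al a m g t al0 Lg.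
pose k s := mittag_leffler al (m * (t - s) `^ al) * weak_derivative a w s.
have E s : s \in `]0, t[%classic -> k s = g s * ml_fun al a m (t - s).
  rewrite inE/= in_itv/= => /andP[s0 st].
  rewrite /ml_fun restrict_itvE subr_ge0 (ltW st)/=.
  rewrite lerBlDr (le_trans ta) ?lerDl ?(ltW s0)//=.
  by rewrite /k /g patchE mem_set ?(mulrC (mittag_leffler _ _))//= in_itv/= s0 (lt_le_trans st).
have Lkg' : mu.-integrable `]0, t[ (EFin \o (fun s => g s * ml_fun al a m (t - s))).
  exact: (integrableS measurableT).
have Lk : mu.-integrable `]0, t[ (EFin \o k).
  by apply: eq_integrable Lkg' => // s st; rewrite /= E.
transitivity (\int[mu]_(s in `[0, t]) k s); first by [].
rewrite Rintegral_itv_oo_cc//.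
have -> : \int[mu]_(s in `]0, t[) k s = \int[mu]_(s in `]0, t[) (g s * ml_fun al a m (t - s)).
  by apply: eq_Rintegral => s st; exact: E.
rewrite -Rintegral_itv_oo_cc//.
rewrite Rintegral_mkcond; apply: eq_Rintegral => s _.
rewrite restrict_itvE [RHS]mulrC; case: ifPn => //; rewrite negb_and -!ltNge.
move=> /orP[s0|ts].
  rewrite /g patchE ifN ?mul0r// notin_setE/= in_itv/=.
  by rewrite (lt_gtF s0).
by rewrite /ml_fun restrict_itvE (lt_geF (_ : t - s < 0)) ?mulr0// subr_lt0.
Qed.

(** For functions with a weak derivative, the ABC equation and the Volterra
    equation it is usually integrated to are equivalent: one gives the other
    through the memory equation, up to a solution of the homogeneous Volterra
    equation. *)
Lemma ABC_Volterra al B a w F : 0 < al < 1 -> 0 < B al -> 0 < a ->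
  {within `[0, a], continuous w} ->
  is_weak_derivative a w (weak_derivative a w) ->
  bounded_measurable (F \_ `[0, a]) ->
  (forall t, 0 <= t <= a -> ABC al B a w t = F t) <->
  (forall t, 0 <= t <= a -> w t = w 0 + (1 - al) / B al *
     (F t + al / (1 - al) * frac_int al a (F \_ `[0, a]) t)).
Proof.
move=> /andP[al0 al1] B0 a0 cw ww bF.
have [Lg wE] := weak_derivative_primitive a w _ a0 cw ww.
set g := weak_derivative a w \_ _ in Lg wE.
pose lam := al / (1 - al); pose K := memory al a (- lam) g.
have al1' : 0 < 1 - al by rewrite subr_gt0.
have lam0 : 0 < lam by rewrite divr_gt0.
have bK : bounded_measurable K by exact: bounded_measurable_memory.
have gN s : ~~ (0 <= s <= a) -> g s = 0.
  move=> sa; rewrite /g patchE ifN// notin_setE/= in_itv/=.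
  by apply/negP; apply: contra sa => /andP[/ltW -> /ltW ->].
have KE t : 0 <= t <= a -> w t - w 0 = K t + lam * frac_int al a K t.
  move=> ta; rewrite wE// addrAC subrr add0r {1}/K.
  rewrite memory_equation//; last by rewrite oppr_eq0 gt_eqF.
  by rewrite -/K mulNr subrK.
have AE t : 0 <= t <= a -> ABC al B a w t = B al / (1 - al) * K t.
  by move=> ta; exact: ABC_memory.
have KN t : t < 0 -> K t = 0 by move=> t0; rewrite /K /memory (lt_geF t0) mul0r.
have FN t : t < 0 -> (F \_ `[0, a]) t = 0 by move=> t0; rewrite restrict_itvE (lt_geF t0).
have FJ t : 0 <= t <= a -> (F \_ `[0, a]) t = F t by move=> ta; rewrite restrict_itvE ta.
have kap : (1 - al) / B al * (B al / (1 - al)) = 1.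
  by field; rewrite !gt_eqF.
split=> H t ta.
  have FK s : s <= t -> (F \_ `[0, a]) s = B al / (1 - al) * K s.
    move=> st; have [s0|s0] := leP 0 s; last by rewrite FN// KN// mulr0.
    have sa : 0 <= s <= a by rewrite s0 (le_trans st)//; case/andP: ta.
    by rewrite FJ// -H// AE.
  rewrite (eq_frac_int _ _ _ _ _ FK) frac_intZ// -H// AE// -/lam.
  rewrite [X in w 0 + _ * X](_ : _ = B al / (1 - al) * (K t + lam * frac_int al a K t)); last by ring.
  by rewrite mulrA kap mul1r -KE// addrC subrK.
pose u t := K t - (1 - al) / B al * (F \_ `[0, a]) t.
have bcF : bounded_measurable (fun t => (1 - al) / B al * (F \_ `[0, a]) t).
  exact: bounded_measurableZ.
have bu : bounded_measurable u by exact: bounded_measurableB.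
have uN s : s < 0 -> u s = 0 by move=> s0; rewrite /u KN// FN// mulr0 subrr.
have uE s : 0 <= s <= a -> `|u s| <= 0 * `|u s| + lam * frac_int al a (fun r => `|u r|) s.
  move=> sa; rewrite mul0r add0r.
  have -> : u s = - (lam * frac_int al a u s).
    rewrite frac_intB// frac_intZ// /u FJ//.
    have := KE s sa; rewrite (H s sa) -/lam => /eqP; rewrite addrAC subrr add0r => /eqP.
    lra.
  rewrite normrN normrM (gtr0_norm lam0) ler_wpM2l ?(ltW lam0)//.
  exact: norm_frac_int.
have ut : u t = 0.
  apply: (Volterra_unique al a 0 lam) => //; rewrite ?lexx ?ltr01 ?(ltW lam0)//.
  by case/andP: ta.
rewrite AE//; move/eqP: ut; rewrite /u FJ// subr_eq0 => /eqP ->.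
by rewrite mulrA mulrC [_ / _ * _]mulrC kap mulr1.
Qed.

End Memory.

(** * Picard iteration *)

Section Picard.
Context {R : realType}.

Lemma geometric_increments_cvg (x : R^nat) (D q : R) : 0 <= q < 1 ->
  (forall n, `|x n.+1 - x n| <= D * q ^+ n) ->
  cvgn x /\ forall n, `|limn x - x n| <= D / (1 - q) * q ^+ n.
Proof.
move=> /andP[q0 q1] xD; have q1' : `|q| < 1 by rewrite ger0_norm.
have q1p : 0 < 1 - q by rewrite subr_gt0.
have D0 : 0 <= D by have := le_trans (normr_ge0 _) (xD 0%N); rewrite expr0 mulr1.
have H n k : `|x (n + k)%N - x n| <= D / (1 - q) * q ^+ n * (1 - q ^+ k).
  elim: k => [|k IH]; first by rewrite addn0 !subrr normr0 mulr0.
  rewrite addnS -[_ - _](subrKA (x (n + k)%N)) (le_trans (ler_normD _ _))//.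
  apply: (le_trans (lerD (xD _) IH)).
  rewrite le_eqVlt; apply/orP; left; apply/eqP; rewrite exprD exprS.
  by field; rewrite gt_eqF.
have cx : cvgn x.
  have E n : x n = x 0%N + series (fun k => x k.+1 - x k) n.
    by rewrite /series/= telescope_sumr// addrC subrK.
  rewrite (_ : x = (fun n => x 0%N + series (fun k => x k.+1 - x k) n)); last exact/funext.
  apply: is_cvgD; first exact: is_cvg_cst.
  apply: normed_cvg; apply: (series_le_cvg _ _ _ (@is_cvg_geometric_series _ D _ q1')).
  - by move=> n; exact: normr_ge0.
  - by move=> n; rewrite /= mulr_ge0 ?exprn_ge0.
  - by move=> n; exact: xD.
split=> // n.
have Hn := cvg_norm (cvgB cx (cvg_cst (x n))).
apply: (cvgr_to_le (Hn _ _ _)); near=> M.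
have nM : (n <= M)%N by near: M; exact: nbhs_infty_ge.
rewrite -(subnKC nM) /= (le_trans (H n (M - n)%N))//.
have Dn0 : 0 <= D / (1 - q) * q ^+ n.
  by rewrite mulr_ge0 ?exprn_ge0// divr_ge0// ltW.
by rewrite ler_piMr// gerBl exprn_ge0.
Unshelve. all: by end_near.
Qed.

Lemma lipschitz_itv_clamp a M (v : R -> R) : 0 <= a -> 0 <= M ->
  (forall s t, 0 <= s -> s <= t -> t <= a -> `|v t - v s| <= M * (t - s)) ->
  forall x y, `|v (clamp a x) - v (clamp a y)| <= M * `|x - y|.
Proof.
move=> a0 M0 vM x y.
wlog xy : x y / clamp a y <= clamp a x => [H|].
  have [/H//|/ltW/H] := leP (clamp a y) (clamp a x).
  by rewrite distrC [in leRHS]distrC.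
have /andP[y0 ya] := clamp_itv a y a0; have /andP[x0 xa] := clamp_itv a x a0.
rewrite (le_trans (vM _ _ y0 xy xa))// ler_wpM2l//.
by rewrite (le_trans _ (clamp_lipschitz a x y))// ler_norm.
Qed.

Lemma lipschitz_itv_continuous a M (v : R -> R) : 0 <= a -> 0 <= M ->
  (forall s t, 0 <= s -> s <= t -> t <= a -> `|v t - v s| <= M * (t - s)) ->
  {within `[0, a], continuous v}.
Proof.
move=> a0 M0 vM.
have cv : continuous (v \o clamp a).
  apply: (lipschitz_continuous M); exact: (lipschitz_itv_clamp a M v a0 M0 vM).
apply: (@subspace_eq_continuous _ _ _ (v \o clamp a)).
  by move=> x; rewrite inE/= in_itv/= => xa; rewrite /= clamp_id.
exact: continuous_subspaceT.
Qed.

Section fixed_point.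
Context (al a c lam l1 l2 w0 : R) (f : R -> R -> R).
Context (al0 : 0 < al) (a0 : 0 <= a) (c0 : 0 <= c) (lam0 : 0 <= lam).
Context (l10 : 0 <= l1) (l20 : 0 <= l2) (cl2 : c * l2 < 1).
Context (f0 : f 0 w0 = 0).
Context (flip : forall s t x y, 0 <= s <= a -> 0 <= t <= a ->
  `|f s x - f t y| <= l1 * `|s - t| + l2 * `|x - y|).

Definition Nemytskii (w : R -> R) : R -> R := (fun t => f t (w t)) \_ `[0, a].

Definition Volterra_map (w : R -> R) (t : R) : R :=
  w0 + c * (Nemytskii w t + lam * frac_int al a (Nemytskii w) t).

(** [K] and [ratio] are the constants for which [Volterra_map] maps the class
    [weighted K] to itself and contracts differences by the factor [ratio];
    the class refines Lipschitz continuity so as to be stable under fractional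
    integration. *)
Section weighted_class.
Context (m ratio K : R) (m_gt0 : 0 < m).
Context (ratioE : ratio = c * l2 * (1 + lam / m)) (ratio_itv : 0 <= ratio < 1).
Context (K_ge0 : 0 <= K) (KE : K = c * (1 + lam / m) * (l1 + l2 * K)).
Let e := ml_fun al a m.

Let lK_ge0 : 0 <= l1 + l2 * K.
Proof. exact: addr_ge0 l10 (mulr_ge0 l20 K_ge0). Qed.

Let e_ge0 t : 0 <= e t. Proof. by apply: ml_fun_ge0 => //; exact: ltW. Qed.

Let e_ge1 t : 0 <= t <= a -> 1 <= e t.
Proof. by apply: ml_fun_ge1 => //; exact: ltW. Qed.

Let e_le s t : s <= t -> t <= a -> e s <= e t.
Proof. by apply: ml_fun_le => //; exact: ltW. Qed.

Let weighted (k : R) (v : R -> R) := forall s t, 0 <= s -> s <= t -> t <= a ->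
  `|v t - v s| <= k * (t - s) * e t.

Let weighted_lipschitz k v : 0 <= k -> weighted k v ->
  forall s t, 0 <= s -> s <= t -> t <= a -> `|v t - v s| <= k * e a * (t - s).
Proof.
move=> k0 kv s t s0 st ta; rewrite (le_trans (kv s t s0 st ta))// mulrAC.
by rewrite ler_wpM2r ?subr_ge0// ler_wpM2l// e_le.
Qed.

Lemma NemytskiiN w t : t < 0 -> Nemytskii w t = 0.
Proof. by move=> t0; rewrite /Nemytskii restrict_itvE (lt_geF t0). Qed.

Let weighted_superposition w : weighted K w ->
  weighted (l1 + l2 * K) (fun t => f t (w t)).
Proof.
move=> Kw s t s0 st ta.
have t0 := le_trans s0 st.
have tJ : 0 <= t <= a by rewrite t0.
have sJ : 0 <= s <= a by rewrite s0 (le_trans st).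
apply: (le_trans (flip _ _ _ _ tJ sJ)).
rewrite ger0_norm ?subr_ge0// !mulrDl lerD//.
  by rewrite ler_peMr ?e_ge1// mulr_ge0// subr_ge0.
rewrite -[leRHS]mulrA -[leRHS]mulrA ler_wpM2l// mulrA; exact: Kw.
Qed.

Let bounded_measurable_Nemytskii w : weighted K w -> bounded_measurable (Nemytskii w).
Proof.
move=> Kw; apply: bounded_measurable_continuous_itv => //.
apply: (lipschitz_itv_continuous a ((l1 + l2 * K) * e a)) => //.
  by rewrite mulr_ge0.
exact: (weighted_lipschitz _ _ lK_ge0 (weighted_superposition w Kw)).
Qed.

(** The condition [f 0 w0 = 0] makes the extension by 0 to negative times as
    regular as the function itself. *)
Let weighted_Nemytskii w : w 0 = w0 -> weighted K w ->
  forall s t, s <= t -> t <= a ->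
  `|Nemytskii w t - Nemytskii w s| <= (l1 + l2 * K) * (t - s) * e t.
Proof.
move=> w00 Kw s t st ta.
have [t0|t0] := leP 0 t; last first.
  rewrite !NemytskiiN ?(le_lt_trans st)// subrr normr0 !mulr_ge0//.
  by rewrite subr_ge0.
have [s0|s0] := leP 0 s.
  by rewrite /Nemytskii !restrict_itvE t0 s0 ta (le_trans st)//=; exact: weighted_superposition.
have -> : Nemytskii w s = f 0 (w 0) by rewrite NemytskiiN// w00 f0.
rewrite /Nemytskii restrict_itvE t0 ta/=.
apply: (le_trans (weighted_superposition w Kw 0 t (lexx _) t0 ta)).
by rewrite ler_wpM2r// ler_wpM2l// lerB// ltW.
Qed.

(** Fractional integration is a convolution: its increment over a time step is
    the fractional integral of the increment of the integrand, to which the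
    weighted estimate applies. *)
Let weighted_frac_int w : w 0 = w0 -> weighted K w ->
  weighted ((l1 + l2 * K) / m) (frac_int al a (Nemytskii w)).
Proof.
move=> w00 Kw s t s0 st ta.
have bN := bounded_measurable_Nemytskii w Kw.
pose N' x := Nemytskii w (x - (t - s)).
have bN' : bounded_measurable N'.
  have [mN [C NC]] := bN; split; last by exists C => x; exact: NC.
  by apply: (measurableT_comp mN); exact: measurable_funB.
have -> : frac_int al a (Nemytskii w) s = frac_int al a N' t.
  apply: eq_Rintegral => r _; rewrite /N'; congr (_ * Nemytskii w _); ring.
rewrite -frac_intB//.
have ts : 0 <= (l1 + l2 * K) * (t - s) by rewrite mulr_ge0// subr_ge0.
have H x : x <= a -> `|Nemytskii w x - N' x| <= (l1 + l2 * K) * (t - s) * e x.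
  move=> xa; have := weighted_Nemytskii w w00 Kw (x - (t - s)) x.
  by rewrite subKr gerBl subr_ge0; apply.
have := norm_frac_int_weight al a m _ _ t al0 m_gt0 ts
  (bounded_measurableB _ _ bN bN') H ta.
by rewrite [_ / m * (t - s)]mulrAC.
Qed.

Let frac_int_Nemytskii0 w : w 0 = w0 -> frac_int al a (Nemytskii w) 0 = 0.
Proof.
move=> w00; rewrite (eq_frac_int al a _ (cst 0)) ?frac_int_cst ?mul0r// => s s0.
move: s0; rewrite le_eqVlt => /predU1P[->|/NemytskiiN//].
by rewrite /Nemytskii restrict_itvE lexx a0/= w00.
Qed.

Let Volterra_map0 w : w 0 = w0 -> Volterra_map w 0 = w0.
Proof.
move=> w00; rewrite /Volterra_map frac_int_Nemytskii0// /Nemytskii restrict_itvE.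
by rewrite lexx a0/= w00 f0 mulr0 addr0 mulr0 addr0.
Qed.

Let weighted_Volterra_map w : w 0 = w0 -> weighted K w -> weighted K (Volterra_map w).
Proof.
move=> w00 Kw s t s0 st ta.
have N1 := weighted_Nemytskii w w00 Kw s t st ta.
have N2 := weighted_frac_int w w00 Kw s t s0 st ta.
rewrite /Volterra_map.
rewrite [X in `|X|](_ : _ = c * ((Nemytskii w t - Nemytskii w s) + lam *
  (frac_int al a (Nemytskii w) t - frac_int al a (Nemytskii w) s))); last by ring.
rewrite normrM (ger0_norm c0).
rewrite [leRHS](_ : _ = c * ((l1 + l2 * K) * (t - s) * e t +
  lam * ((l1 + l2 * K) / m * (t - s) * e t))); last by rewrite {1}KE; ring.
rewrite ler_wpM2l// (le_trans (ler_normD _ _))// lerD// normrM (ger0_norm lam0).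
by rewrite ler_wpM2l.
Qed.

Let contraction_Volterra_map w v D : 0 <= D -> weighted K w -> weighted K v ->
  (forall t, 0 <= t <= a -> `|w t - v t| <= D * e t) ->
  forall t, 0 <= t <= a -> `|Volterra_map w t - Volterra_map v t| <= ratio * D * e t.
Proof.
move=> D0 Kw Kv wv t ta.
have bw := bounded_measurable_Nemytskii w Kw.
have bv := bounded_measurable_Nemytskii v Kv.
have l2D : 0 <= l2 * D by rewrite mulr_ge0.
have H s : s <= a -> `|Nemytskii w s - Nemytskii v s| <= l2 * D * e s.
  move=> sa; have [s0|s0] := leP 0 s; last first.
    by rewrite !NemytskiiN// subrr normr0 mulr_ge0.
  have sJ : 0 <= s <= a by rewrite s0.
  rewrite /Nemytskii !restrict_itvE sJ (le_trans (flip _ _ _ _ sJ sJ))//.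
  by rewrite subrr normr0 mulr0 add0r -mulrA ler_wpM2l// wv.
have ta' : t <= a by case/andP: ta.
have H2 := norm_frac_int_weight al a m _ _ t al0 m_gt0 l2D (bounded_measurableB _ _ bw bv) H ta'.
rewrite frac_intB// in H2.
rewrite /Volterra_map.
rewrite [X in `|X|](_ : _ = c * ((Nemytskii w t - Nemytskii v t) + lam *
  (frac_int al a (Nemytskii w) t - frac_int al a (Nemytskii v) t))); last by ring.
rewrite normrM (ger0_norm c0).
rewrite [leRHS](_ : _ = c * (l2 * D * e t + lam * (l2 * D / m * e t))); last first.
  by rewrite ratioE; ring.
rewrite ler_wpM2l// (le_trans (ler_normD _ _))// lerD//; first exact: H.
by rewrite normrM (ger0_norm lam0) ler_wpM2l.
Qed.

Lemma weighted_fixed_point : exists (w : R -> R) (M : R),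
  [/\ w 0 = w0, 0 <= M,
      forall s t, 0 <= s -> s <= t -> t <= a -> `|w t - w s| <= M * (t - s) &
      forall t, 0 <= t <= a -> w t = Volterra_map w t].
Proof.
have /andP[r0 r1] := ratio_itv.
have r1p : 0 < 1 - ratio by rewrite subr_gt0.
pose it n := iter n Volterra_map (cst w0).
have itS n : it n.+1 = Volterra_map (it n) by [].
have it0 n : it n 0 = w0 by elim: n => // n IH; rewrite itS Volterra_map0.
have Kit n : weighted K (it n).
  elim: n => [s t s0 st ta|n IH]; last by rewrite itS; exact: weighted_Volterra_map.
  by rewrite /it/= subrr normr0 !mulr_ge0// subr_ge0.
pose D := K * a; have D0 : 0 <= D by rewrite mulr_ge0.
have itD n t : 0 <= t <= a -> `|it n.+1 t - it n t| <= D * e t * ratio ^+ n.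
  elim: n t => [|n IH] t ta.
    have /andP[t0 ta'] := ta.
    have := Kit 1%N 0 t (lexx _) t0 ta'; rewrite it0 subr0 expr0 mulr1 => /le_trans; apply.
    by rewrite ler_wpM2r// ler_wpM2l.
  have H s : 0 <= s <= a -> `|it n.+1 s - it n s| <= D * ratio ^+ n * e s.
    by move=> sa; rewrite mulrAC IH.
  have Dn : 0 <= D * ratio ^+ n by rewrite mulr_ge0// exprn_ge0.
  rewrite !itS (le_trans (contraction_Volterra_map _ _ _ Dn (Kit _) (Kit _) H t ta))//.
  by rewrite le_eqVlt; apply/orP; left; apply/eqP; rewrite exprS; ring.
have cvgit t : 0 <= t <= a -> cvgn (fun n => it n t) /\
    forall n, `|limn (fun n => it n t) - it n t| <= D * e t / (1 - ratio) * ratio ^+ n.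
  by move=> ta; apply: geometric_increments_cvg ratio_itv _ => n; exact: itD.
pose w t := limn (fun n => it n t).
have wE t : 0 <= t <= a -> it n t @[n --> \oo] --> w t.
  by move=> ta; have [] := cvgit t ta.
have w00 : w 0 = w0.
  rewrite /w (_ : (fun n => it n 0) = cst w0) ?lim_cst//.
  by apply/funext => n; exact: it0.
have Kw : weighted K w.
  move=> s t s0 st ta.
  have tJ : 0 <= t <= a by rewrite (le_trans s0).
  have sJ : 0 <= s <= a by rewrite s0 (le_trans st).
  have Hn := cvg_norm (cvgB (wE t tJ) (wE s sJ)).
  by apply: (cvgr_to_le (Hn _ _)); apply: nearW => n; exact: Kit.
exists w, (K * e a); split => //.
- by rewrite mulr_ge0.
- exact: weighted_lipschitz.
move=> t ta; apply/eqP; rewrite -subr_eq0; apply/eqP.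
apply: (eq0_geometric_bound ratio _ (2 * (ratio * (D * e t / (1 - ratio))))) => [|n].
  by rewrite ger0_norm.
rewrite -[_ - _](subrKA (it n.+1 t)) (le_trans (ler_normD _ _))//.
have [_ /(_ n.+1) H1] := cvgit t ta.
pose Dn := D / (1 - ratio) * ratio ^+ n.
have Dn0 : 0 <= Dn by rewrite mulr_ge0 ?divr_ge0 ?exprn_ge0// ltW.
have H2 s : 0 <= s <= a -> `|it n s - w s| <= Dn * e s.
  move=> sa; rewrite distrC; have [_ /(_ n)] := cvgit s sa.
  by move=> /le_trans; apply; rewrite le_eqVlt; apply/orP; left; apply/eqP; rewrite /Dn; ring.
have := contraction_Volterra_map _ _ _ Dn0 (Kit n) Kw H2 t ta; rewrite -itS => H3.
apply: (le_trans (lerD H1 H3)).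
by rewrite le_eqVlt; apply/orP; left; apply/eqP; rewrite /Dn exprS; ring.
Qed.

End weighted_class.

(** The Picard iterates stay in a class of Lipschitz functions described by
    the weight, which is what puts the solution in the Sobolev space. *)
Lemma Volterra_fixed_point : exists (w : R -> R) (M : R),
  [/\ w 0 = w0, 0 <= M,
      forall s t, 0 <= s -> s <= t -> t <= a -> `|w t - w s| <= M * (t - s) &
      forall t, 0 <= t <= a -> w t = Volterra_map w t].
Proof.
have h : 0 < 1 - c * l2 by rewrite subr_gt0.
(* large enough for [ratio] to be less than 1 *)
pose m := c * l2 * lam / (1 - c * l2) + 1.
have m0 : 0 < m by rewrite ltr_wpDl// divr_ge0 ?mulr_ge0// ltW.
have lm0 : 0 <= 1 + lam / m by rewrite addr_ge0// divr_ge0// ltW.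
pose ratio := c * l2 * (1 + lam / m).
have r1 : ratio < 1.
  rewrite /ratio mulrDr mulr1 addrC -ltrBrDr mulrA ltr_pdivrMr// /m mulrDr mulr1.
  rewrite [X in _ < X + _](_ : _ = c * l2 * lam); first by rewrite ltrDl.
  by field; rewrite gt_eqF.
have r0 : 0 <= ratio by rewrite !mulr_ge0.
have r1' : 0 < 1 - ratio by rewrite subr_gt0.
pose K := c * l1 * (1 + lam / m) / (1 - ratio).
have K0 : 0 <= K by rewrite divr_ge0 ?(ltW r1')// !mulr_ge0.
apply: (weighted_fixed_point m ratio K) => //; first by rewrite r0.
have : K * (1 - ratio) = c * l1 * (1 + lam / m) by rewrite /K divfK// gt_eqF.
rewrite mulrBr mulr1 => /eqP; rewrite subr_eq => /eqP {1}->.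
by rewrite /ratio; ring.
Qed.

End fixed_point.
End Picard.

(** * Solutions of the initial value problem *)

Section solutions.
Context {R : realType}.
Context (al a w0 l1 l2 : R) (B : R -> R) (f : R -> R -> R).
Context (al01 : 0 < al < 1) (B_gt0 : 0 < B al) (a_gt0 : 0 < a).
Context (l1_ge0 : 0 <= l1) (l2_ge0 : 0 <= l2) (l2_lt : l2 < B al / (1 - al)).
Context (f0 : f 0 w0 = 0).
Context (flip : forall s t x y, 0 <= s <= a -> 0 <= t <= a ->
  `|f s x - f t y| <= l1 * `|s - t| + l2 * `|x - y|).

Let c := (1 - al) / B al.
Let lam := al / (1 - al).

Let al_gt0 : 0 < al. Proof. by case/andP: al01. Qed.
Let onem_gt0 : 0 < 1 - al. Proof. by rewrite subr_gt0; case/andP: al01. Qed.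
Let c_gt0 : 0 < c. Proof. by rewrite divr_gt0. Qed.
Let lam_gt0 : 0 < lam. Proof. by rewrite divr_gt0. Qed.
Let a_ge0 : 0 <= a := ltW a_gt0.

Let cl2 : c * l2 < 1.
Proof. by rewrite /c mulrAC ltr_pdivrMr// mul1r mulrC -ltr_pdivlMr. Qed.

Lemma H1_weak_derivative w : H1 a w -> is_weak_derivative a w (weak_derivative a w).
Proof. by move=> [_ [g wg]]; exact: (xgetPex (fun=> 0) (ex_intro _ g wg)). Qed.

Lemma is_solution_Volterra w : is_solution al B f w0 a w ->
  bounded_measurable (Nemytskii a f w) /\
  forall t, 0 <= t <= a -> w t = Volterra_map al a c lam w0 f w t.
Proof.
move=> [H1w cw cABC eqn w00].
have eqn' t : 0 <= t <= a -> ABC al B a w t = f t (w t).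
  by move=> ta; apply: eqn; rewrite in_itv.
have bF : bounded_measurable (Nemytskii a f w).
  have := bounded_measurable_continuous_itv a _ a_ge0 cABC.
  rewrite (_ : _ \_ _ = Nemytskii a f w)//; apply/funext => t.
  by rewrite /Nemytskii !restrict_itvE; case: ifP => // /eqn'.
split=> // t ta; have [H _] := ABC_Volterra al B a w (fun t => f t (w t)) al01
  B_gt0 a_gt0 cw (H1_weak_derivative w H1w) bF.
have -> : Volterra_map al a c lam w0 f w t =
    w0 + c * (f t (w t) + lam * frac_int al a (Nemytskii a f w) t).
  by rewrite /Volterra_map [in X in _ * (X + _)]/Nemytskii restrict_itvE ta.
by rewrite -w00; exact: H.
Qed.

Lemma is_solution_unique w v : is_solution al B f w0 a w ->
  is_solution al B f w0 a v -> forall t, 0 <= t <= a -> w t = v t.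
Proof.
move=> sw sv; have [bw wE] := is_solution_Volterra w sw.
have [bv vE] := is_solution_Volterra v sv.
have [_ cw _ _ _] := sw; have [_ cv _ _ _] := sv.
pose u := (fun t => w t - v t) \_ `[0, a].
have bu : bounded_measurable u.
  apply: bounded_measurable_continuous_itv => // x.
  by apply: cvgB; [exact: cw|exact: cv].
have uJ t : 0 <= t <= a -> u t = w t - v t by move=> ta; rewrite /u restrict_itvE ta.
have uN t : t < 0 -> u t = 0 by move=> t0; rewrite /u restrict_itvE (lt_geF t0).
have NJ x t : 0 <= t <= a -> Nemytskii a f x t = f t (x t).
  by move=> ta; rewrite /Nemytskii restrict_itvE ta.
have H s : s <= a -> `|Nemytskii a f w s - Nemytskii a f v s| <= l2 * `|u s|.
  move=> sa; have [s0|s0] := leP 0 s; last by rewrite !NemytskiiN// subrr normr0 mulr_ge0.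
  have sJ : 0 <= s <= a by rewrite s0.
  rewrite !NJ// uJ// (le_trans (flip _ _ _ _ sJ sJ))//.
  by rewrite subrr normr0 mulr0 add0r.
have uE t : 0 <= t <= a ->
    `|u t| <= c * l2 * `|u t| + c * lam * l2 * frac_int al a (fun s => `|u s|) t.
  move=> ta; have ta' : t <= a by case/andP: ta.
  rewrite {1}uJ// wE// vE// /Volterra_map.
  rewrite [X in `|X|](_ : _ = c * (Nemytskii a f w t - Nemytskii a f v t) + c * lam *
    (frac_int al a (Nemytskii a f w) t - frac_int al a (Nemytskii a f v) t)); last by ring.
  have cl0 : 0 < c * lam by rewrite mulr_gt0.
  rewrite (le_trans (ler_normD _ _))// lerD// normrM.
    by rewrite (gtr0_norm c_gt0) -mulrA ler_wpM2l ?(ltW c_gt0)// H.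
  rewrite (gtr0_norm cl0) -[leRHS]mulrA ler_wpM2l ?(ltW cl0)// -frac_intB//.
  have bu' := bounded_measurable_norm _ bu.
  have bB := bounded_measurableB _ _ bw bv.
  apply: (le_trans (norm_frac_int _ _ _ _ al_gt0 bB)).
  rewrite -frac_intZ//; apply: le_frac_int => //.
  - exact: bounded_measurable_norm.
  - exact: bounded_measurableZ.
  - by move=> s st; apply: H; exact: le_trans ta'.
move=> t ta; apply/eqP; rewrite -subr_eq0 -uJ//; apply/eqP.
apply: (Volterra_unique al a (c * l2) (c * lam * l2)) => //.
- by rewrite cl2 mulr_ge0// ltW.
- exact: mulr_ge0 (mulr_ge0 (ltW c_gt0) (ltW lam_gt0)) l2_ge0.
- by case/andP: ta.
Qed.

(** The fixed point on [0, a] is extended to a Lipschitz function on the line,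
    whose density is then a weak derivative. *)
Lemma is_solution_exists : exists eta, is_solution al B f w0 a eta.
Proof.
have [v [M [v0 M0 vM vE]]] := Volterra_fixed_point al a c lam l1 l2 w0 f al_gt0
  a_ge0 (ltW c_gt0) (ltW lam_gt0) l1_ge0 l2_ge0 cl2 f0 flip.
pose w := v \o clamp a.
have wv t : 0 <= t <= a -> w t = v t by move=> ta; rewrite /w /= clamp_id.
have w00 : w 0 = w0 by rewrite wv ?lexx.
have wM x y : `|w x - w y| <= (M + 1) * `|x - y|.
  apply: (le_trans (lipschitz_itv_clamp a M v a_ge0 M0 vM x y)).
  by rewrite ler_wpM2r// lerDl.
have cw : continuous w := lipschitz_continuous (M + 1) w wM.
have cwJ : {within `[0, a], continuous w} by exact: continuous_subspaceT.
have M1 : 0 < M + 1 by rewrite ltr_wpDl.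
have [h [mh hM wh]] := lipschitz_density (M + 1) w a M1 a_ge0 wM.
have wd : is_weak_derivative a w h by exact: (primitive_weak_derivative a w h (M + 1)).
have H1w : H1 a w.
  split; last by exists h.
  have [mw [C wC]] := bounded_measurable_continuous_itv a w a_ge0 cwJ.
  apply: (bounded_in_L2 a C).
    by apply: (measurable_funS measurableT) => //; exact: continuous_measurable_fun.
  move=> x /andP[x0 xa]; have := wC x.
  by rewrite restrict_itvE (ltW x0) (ltW xa).
have cF : {within `[0, a], continuous (fun t => f t (w t))}.
  apply: (lipschitz_itv_continuous a (l1 + l2 * (M + 1))) => //.
    by rewrite addr_ge0// mulr_ge0// ltW.
  move=> s t s0 st ta.
  have tJ : 0 <= t <= a by rewrite ta (le_trans s0).
  have sJ : 0 <= s <= a by rewrite s0 (le_trans st).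
  rewrite (le_trans (flip _ _ _ _ tJ sJ))// mulrDl.
  have := wM t s; rewrite (@ger0_norm _ (t - s)) ?subr_ge0// => wts.
  by rewrite lerD// -mulrA ler_wpM2l.
have bF := bounded_measurable_continuous_itv a _ a_ge0 cF.
have [_ H] := ABC_Volterra al B a w (fun t => f t (w t)) al01
  B_gt0 a_gt0 cwJ (H1_weak_derivative w H1w) bF.
have NE : Nemytskii a f v = (fun t => f t (w t)) \_ `[0, a].
  apply/funext => t; rewrite /Nemytskii !restrict_itvE; case: ifP => // ta.
  by rewrite wv.
have eqn t : 0 <= t <= a -> ABC al B a w t = f t (w t).
  apply: H => s sa.
  have Ns : Nemytskii a f v s = f s (w s) by rewrite NE restrict_itvE sa.
  by rewrite w00 {1}wv// vE// /Volterra_map Ns NE.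
exists w; split => //.
apply: (@subspace_eq_continuous _ _ _ (fun t => f t (w t))) => // t.
by rewrite inE/= in_itv/= => ta; exact/esym/eqn.
Qed.

End solutions.

Theorem theorem5p4 (R : realType) (alpha : R) (B : R -> R) (T w0 b M L1 L2 : R)
    (f : R -> R -> R) :
  0 < alpha < 1 ->
  0 < B alpha -> B 0 = 1 -> B 1 = 1 ->
  0 < T -> 0 < b -> 0 < M ->
  {within `[0, T] `*` [set: R], continuous (fun p : R * R => f p.1 p.2)} ->
  f 0 w0 = 0 ->
  (forall tau w, tau \in `[0, T] -> `|w - w0| <= b -> `|f tau w| <= M) ->
  0 < L1 -> 0 < L2 < B alpha / (1 - alpha) ->
  (forall tau1 tau2 w eta, tau1 \in `[0, T] -> tau2 \in `[0, T] ->
     `|f tau1 w - f tau2 eta| <= L1 * `|tau1 - tau2| + L2 * `|w - eta|) ->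
  (2 * M + b) * (1 - alpha) < b * B alpha ->
  let beta0 := Num.min T
    (((b * B alpha - (2 * M + b) * (1 - alpha)) * Gamma alpha / (2 * M + b))
       `^ alpha^-1) in
  (exists eta : R -> R, is_maximal_solution alpha B f w0 beta0 eta) /\
  (exists eta : R -> R, is_minimal_solution alpha B f w0 beta0 eta).
Proof.
move=> al01 B0 _ _ T0 b0 M0 _ f0 _ l10 /andP[l20 l2B] flip Mb beta0.
have al0 : 0 < alpha by case/andP: al01.
have Mb0 : 0 < 2 * M + b by rewrite addr_gt0// mulr_gt0.
have beta0_gt0 : 0 < beta0.
  rewrite /beta0 lt_min T0 powR_gt0// divr_gt0// mulr_gt0 ?subr_gt0//.
  exact: Gamma_gt0.
have beta0T : beta0 <= T by rewrite /beta0 ge_min lexx.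
have flip' s t x y : 0 <= s <= beta0 -> 0 <= t <= beta0 ->
    `|f s x - f t y| <= L1 * `|s - t| + L2 * `|x - y|.
  move=> /andP[s0 sb] /andP[t0 tb].
  by apply: flip; rewrite in_itv/= ?s0 ?t0 (le_trans _ beta0T).
have [eta seta] := is_solution_exists alpha beta0 w0 L1 L2 B f al01 B0 beta0_gt0
  (ltW l10) (ltW l20) l2B f0 flip'.
have uniq w : is_solution alpha B f w0 beta0 w ->
    forall t, t \in `[0, beta0] -> w t = eta t.
  move=> sw t; rewrite in_itv/=.
  exact: (is_solution_unique alpha beta0 w0 L1 L2 B f al01 B0 beta0_gt0
    (ltW l20) l2B flip').
by split; exists eta; split=> // w sw t tJ; rewrite (uniq w sw t tJ).
Qed.
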